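(* Let $n\ge2$, let $m^{(n-1)}=(m_1,\dots,m_{n-1})$ be I-realizable on $\mathbb{N}_0$, let $\widetilde m_n$ be the smallest real number for which $\widetilde m^{(n)}=(m_1,\dots,m_{n-1},\widetilde m_n)$ is realizable on $\mathbb{N}_0$, and let $\mu$ be the (unique) probability measure realizing $\widetilde m^{(n)}$ on $\mathbb{N}_0$. Then the set $\mathcal{N}_n^m$ produced in step 1, 3, or 6 of the recursive algorithm described in the context (applied to $m^{(n-1)}$) is the support of $\mu$.
   Context: $\mathbb{N}_0=\{0,1,2,\dots\}$. A moment vector $m=m^{(n)}=(m_1,\dots,m_n)$ is an $n$-tuple of real numbers; by convention $m_0=1$, and $m^{(j)}=(m_1,\dots,m_j)$. It is realizable on $\mathbb{X}\subset\mathbb{R}$ if there is a probability measure on $\mathbb{X}$ whose $k$-th moment is $m_k$ for $k=1,\dots,n$. For $P(x)=\sum_{k=0}^n p_kx^k$, $L_P(m)=\sum_{k=0}^n p_km_k$. For $k\ge 0$, $\mathcal{P}_k$ is the set of monic polynomials of degree $k$ with $k$ distinct roots in $\mathbb{N}_0$ which are nonnegative on $\mathbb{N}_0$ ($\mathcal{P}_0=\{1\}$). A moment vector $m^{(n)}$ realizable on $\mathbb{N}_0$ is I-realizable on $\mathbb{N}_0$ if $L_P(m)>0$ for all $P\in\mathcal{P}_n\cup\mathcal{P}_{n-1}$, and B-realizable otherwise. A minimizing polynomial for $m^{(n)}$ is a $P\in\mathcal{P}_n$ with $L_P(m)\le L_{P'}(m)$ for all $P'\in\mathcal{P}_n$;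 whether $P$ is minimizing does not depend on $m_n$. Hankel matrices: $A(k)=(m_{i+j})_{i,j=0}^k$, $B(k)=(m_{i+j+1})_{i,j=0}^k$. Algorithm. Input: an I-realizable (on $\mathbb{N}_0$) vector $m^{(n-1)}$, $n\ge2$ (in evaluating $L_Q(m)$ for $Q$ of degree $n$, $m_n$ is any fixed real number). Output: a finite set $\mathcal{N}_n^m$. 1. (Base cases.) If $n=2$: $\mathcal{N}_2^m=\{m_1\}$ if $m_1\in\mathbb{N}_0$ and otherwise $\mathcal{N}_2^m=\{\lfloor m_1\rfloor,\lfloor m_1\rfloor+1\}$. If $n=3$: $\mathcal{N}_3^m=\{0,m_2/m_1\}$ if $m_2/m_1\in\mathbb{N}_0$, and otherwise $\mathcal{N}_3^m=\{0,\lfloor m_2/m_1\rfloor,\lfloor m_2/m_1\rfloor+1\}$. For $n\ge4$: 2. Determine the finite set denoted $\operatorname{supp}\nu$: if $n=2k$, $\operatorname{supp}\nu=\{y_1,\dots,y_k\}$, where $y_1<\dots<y_k$ are the roots of $x^k-\sum_{i=0}^{k-1}\varphi_ix^i=0$ with $(\varphi_0,\dots,\varphi_{k-1})=(m_k,\dots,m_{n-1})A(k-1)^{-1}$; if $n=2k+1$, $\operatorname{supp}\nu=\{0,y_1,\dots,y_k\}$, where $0<y_1<\dots<y_k$ and $0,y_1,\dots,y_k$ are the roots of $x^{k+1}-\sum_{i=1}^k\varphi_ix^i=0$ with $(\varphi_1,\dots,\varphi_k)=(m_{k+1},\dots,m_{n-1})B(k-1)^{-1}$. (It is the support of the measure $\nu$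 on $[0,\infty)$ that realizes $m^{(n-1)}$ with minimal possible $n$-th moment.) Put $Y_l=\lfloor y_l\rfloor$. 3. If $\operatorname{supp}\nu\subset\mathbb{N}_0$ then $\mathcal{N}_n^m=\operatorname{supp}\nu$. 4. If $\operatorname{supp}\nu\not\subset\mathbb{N}_0$ then for each $l=1,\dots,k$ define $M_l(m)$ by $$M_{l,i}(m)=\frac{m_{i+2}-(2Y_l+1)m_{i+1}+Y_l(Y_l+1)m_i}{m_2-(2Y_l+1)m_1+Y_l(Y_l+1)},\qquad i=0,\dots,n-2$$ (the denominator is positive, $M_{l,0}(m)=1$, and $(M_{l,1}(m),\dots,M_{l,n-3}(m))$ is I-realizable on $\mathbb{N}_0$). Apply the algorithm recursively, with $n-2$ in place of $n$, to $(M_{l,1}(m),\dots,M_{l,n-3}(m))$, obtaining a set $\mathcal{N}_{l,n-2}^{M(m)}$. If $\mathcal{N}_{l,n-2}^{M(m)}\cap\{Y_l,Y_l+1\}\ne\emptyset$ then reject this value of $l$. 5. Choose for each non-rejected $l$ a polynomial $Q_l\in\mathcal{P}_n$ whose set of roots contains $\mathcal{N}_{l,n-2}^{M(m)}\cup\{Y_l,Y_l+1\}$. 6. Find $i$ such that $L_{Q_i}(m)$ is minimal among all the $L_{Q_l}(m)$ ($l$ non-rejected). Then $Q_i$ is a minimizing polynomial for $m^{(n)}$, and there is a unique probability measure realizing $m^{(n-1)}$ with support in the zero set of $Q_i$; $\mathcal{N}_n^m$ is the support of this measure. *)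

(* Defs.v *)
From HB Require Import structures.
From mathcomp Require Import all_boot all_order all_algebra.
From mathcomp Require Import all_classical all_reals all_analysis.
Set Implicit Arguments.
Unset Strict Implicit.
Unset Printing Implicit Defensive.
Import Order.TTheory GRing.Theory Num.Theory.
Import numFieldNormedType.Exports.
Local Open Scope classical_set_scope.
Local Open Scope ring_scope.

(* A moment vector (m_1, ..., m_n) is a sequence of size n, 0-based as a
   sequence; [mom m k] is m_k, with the convention m_0 = 1. *)
Definition mom (R : realType) (m : seq R) (k : nat) : R := nth 0 (1 :: m) k.

Definition N0 (R : realType) : set R := [set x : R | x \is a Num.nat].

(* [mu (~` X) = 0] expresses that mu lives on X when X is measurable. *)
Definition realizes (R : realType) (X : set R)
    (mu : probability (measurableTypeR R) R) (m : seq R) : Prop :=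
  mu (~` X) = 0%E /\
  forall k : nat, (1 <= k <= size m)%N ->
    mu.-integrable setT (fun x : measurableTypeR R => (x ^+ k)%:E) /\
    (\int[mu]_(x in setT) (x ^+ k)%:E)%E = (mom m k)%:E.

Definition realizable (R : realType) (X : set R) (m : seq R) : Prop :=
  exists mu : probability (measurableTypeR R) R, realizes X mu m.

Definition msupport (R : realType)
    (mu : probability (measurableTypeR R) R) : set R :=
  [set x : R | forall U : set R, open U -> U x -> (0 < mu U)%E].

(* L_P(m); meant for P of degree at most the length of m. *)
Definition Lfun (R : realType) (P : {poly R}) (m : seq R) : R :=
  \sum_(k < (size m).+1) P`_k * mom m k.

Definition Pclass (R : realType) (k : nat) (P : {poly R}) : Prop :=
  [/\ P \is monic, size P = k.+1,
      exists s : seq nat,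
        [/\ uniq s, size s = k & forall a : nat, a \in s -> root P a%:R]
    & forall x : nat, 0 <= P.[x%:R]].

Definition I_realizable (R : realType) (m : seq R) : Prop :=
  realizable (@N0 R) m /\
  forall P : {poly R},
    Pclass (size m) P \/ Pclass (size m).-1 P -> 0 < Lfun P m.

Definition rfloor (R : realType) (x : R) : R := (Num.floor x)%:~R.

Definition bracket (R : realType) (x : R) : set R :=
  if x \is a Num.nat then [set x] else [set rfloor x; rfloor x + 1].

(* k x k Hankel matrix: A(k-1) is [hankel 0 m k], B(k-1) is [hankel 1 m k]. *)
Definition hankel (R : realType) (s : nat) (m : seq R) (k : nat) : 'M[R]_k :=
  \matrix_(i < k, j < k) mom m (i + j + s).

(* The polynomial whose roots form supp nu. Here s = 0 if n = 2k and s = 1 if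
   n = 2k+1; in the latter case the coefficient of index i of [phi] is
   phi_(i+1). *)
Definition nu_poly (R : realType) (s : nat) (m : seq R) (k : nat) : {poly R} :=
  let phi : 'rV[R]_k :=
    (\row_(j < k) mom m (k + s + j)) *m invmx (hankel s m k) in
  'X^(k + s) - \sum_(i < k) phi 0 i *: 'X^(i + s).

(* supp nu as a list, given y = [:: y_1; ...; y_k]. *)
Definition supp_nu (R : realType) (n : nat) (y : seq R) : seq R :=
  if odd n then 0 :: y else y.

Definition is_nu_points (R : realType) (m : seq R) (y : seq R) : Prop :=
  let n := (size m).+1 in
  [/\ size y = n./2, sorted <%R (supp_nu n y)
    & forall x : R, root (nu_poly (odd n) m n./2) x = (x \in supp_nu n y)].

(* M_{l,i}(m) with Y = Y_l. *)
Definition Mentry (R : realType) (m : seq R) (Y : R) (i : nat) : R :=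
  (mom m (i + 2) - (2 * Y + 1) * mom m (i + 1) + Y * (Y + 1) * mom m i) /
  (mom m 2 - (2 * Y + 1) * mom m 1 + Y * (Y + 1)).

(* (M_{l,1}(m), ..., M_{l,n-3}(m)), where n - 3 = size m - 2. *)
Definition Mvec (R : realType) (m : seq R) (Y : R) : seq R :=
  [seq Mentry m Y i | i <- iota 1 (size m - 2)].

(* [algorithm m N]: some execution of the algorithm on the input m = m^(n-1),
   n = size m + 1, outputs N. It is a relation because the polynomials Q_l, the
   minimizing index and the auxiliary real c (standing for m_n) are chosen
   arbitrarily. Indices are 0-based: [Y l] is Y_{l+1}. *)
Inductive algorithm (R : realType) : seq R -> set R -> Prop :=
| Alg_two (m1 : R) : algorithm [:: m1] (bracket m1)
| Alg_three (m1 m2 : R) :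
    algorithm [:: m1; m2] ([set 0] `|` bracket (m2 / m1))
| Alg_integral (m y : seq R) :
    (4 <= (size m).+1)%N ->
    is_nu_points m y ->
    [set` supp_nu (size m).+1 y] `<=` @N0 R ->
    algorithm m [set` supp_nu (size m).+1 y]
| Alg_recursive (m y : seq R) (Nl : nat -> set R) (Q : nat -> {poly R}) (c : R)
    (i : nat) (mu : probability (measurableTypeR R) R) :
    let n := (size m).+1 in
    let Y := fun l : nat => rfloor y`_l in
    let kept := fun l : nat =>
      (l < size y)%N /\ Nl l `&` [set Y l; Y l + 1] = set0 in
    (4 <= n)%N ->
    is_nu_points m y ->
    ~ ([set` supp_nu n y] `<=` @N0 R) ->
    (forall l : nat, (l < size y)%N -> algorithm (Mvec m (Y l)) (Nl l)) ->
    (forall l : nat, kept l ->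
       Pclass n (Q l) /\
       Nl l `|` [set Y l; Y l + 1] `<=` [set x : R | root (Q l) x]) ->
    kept i ->
    (forall l : nat, kept l ->
       Lfun (Q i) (rcons m c) <= Lfun (Q l) (rcons m c)) ->
    realizes setT mu m ->
    msupport mu `<=` [set x : R | root (Q i) x] ->
    algorithm m (msupport mu).

(* Main.v *)
From HB Require Import structures.
Require Import Defs.
From mathcomp Require Import all_boot all_order all_algebra.
From mathcomp Require Import all_classical all_reals all_analysis.
From mathcomp Require Import measurable_realfun polyrcf lra zify ring.
Set Implicit Arguments.
Unset Strict Implicit.
Unset Printing Implicit Defensive.
(* Defs is imported again because all_analysis has its own Lfun. *)
Import Defs Order.TTheory GRing.Theory Num.Theory.
Import numFieldNormedType.Exports.
Local Open Scope ring_scope.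

(* Write n = 2k + s with s = 0 or 1. The minimal measure mu is carried, apart
   from the point 0 if s = 1, by k disjoint pairs {a, a + 1}: otherwise its
   support contains k + 1 points s <= t_0 < ... < t_k with gaps at least 2, and
   a small multiple of the divided difference of order n at the points t_i and
   t_i - 1 can be subtracted from mu, which lowers the n-th moment. A polynomial
   of P_n that vanishes on mu is thus minimizing, and it determines mu.
   The set supp nu consists of 0 (if s = 1) and the roots y_1, ..., y_k of the
   polynomial F orthogonal, for x^s mu, to all polynomials of degree < k. If no
   y_l lies strictly inside one of the k pairs, then F has a constant sign on
   each pair, some G of degree < k has the same signs, and the integral of F G
   vanishes, so that mu lives on supp nu. Otherwise some y_l lies in a pair
   {Y_l, Y_l + 1}; weighting mu by (x - Y_l)(x - Y_l - 1) deletes exactly this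
   pair and gives the minimal measure for M_l(m). Hence this l is kept and its
   Q_l vanishes on mu, as then does every Q_i at which the minimum is attained. *)

(** * Families of disjoint pairs of consecutive integers *)

(** A list of left endpoints a encodes the pairs {a, a + 1}; the new bound [a.+2] makes them
    disjoint. Read as a list of points, the same condition describes a chain with gaps at least
    2. *)
Fixpoint gapped (s : nat) (D : seq nat) : bool :=
  if D is a :: D' then (s <= a)%N && gapped a.+2 D' else true.

Definition in_pairs (D : seq nat) (x : nat) : bool :=
  has (fun a => (x == a) || (x == a.+1)) D.

Definition covered (s : nat) (D : seq nat) (x : nat) : bool :=
  (x < s)%N || in_pairs D x.

Lemma gapped_weak s t D : (s <= t)%N -> gapped t D -> gapped s D.
Proof. by case: D => //= a D st /andP[ta ->]; rewrite (leq_trans st ta). Qed.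

Lemma gapped_ge s D a : gapped s D -> a \in D -> (s <= a)%N.
Proof.
elim: D s => //= b D IH s /andP[sb gD]; rewrite inE => /orP[/eqP->//|aD].
by have := IH _ gD aD; lia.
Qed.

Lemma gapped_sep s D a b : gapped s D -> a \in D -> b \in D ->
  [\/ a = b, (a.+2 <= b)%N | (b.+2 <= a)%N].
Proof.
elim: D s => //= c D IH s /andP[sc gD]; rewrite !inE.
move=> /orP[/eqP->|aD] /orP[/eqP->|bD].
- exact: Or31.
- by apply: Or32; have := gapped_ge gD bD.
- by apply: Or33; have := gapped_ge gD aD.
- exact: IH gD aD bD.
Qed.

Lemma gapped_uniq s D : gapped s D -> uniq D.
Proof.
elim: D s => //= a D IH s /andP[sa gD]; rewrite (IH _ gD) andbT.
by apply/negP => /(gapped_ge gD); lia.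
Qed.

Lemma gapped_rem s D a : gapped s D -> gapped s (rem a D).
Proof.
elim: D s => //= b D IH s /andP[sb gD]; case: eqP => [_|_] /=.
  by apply: gapped_weak gD; lia.
by rewrite sb (IH _ gD).
Qed.

Lemma in_pairs_rem s D a x : gapped s D -> a \in D ->
  in_pairs D x = (x == a) || (x == a.+1) || in_pairs (rem a D) x.
Proof.
by move=> gD aD; rewrite /in_pairs (perm_has _ (perm_to_rem aD)).
Qed.

(** A collision is resolved by moving right: the leftmost of two meeting pairs is kept, and what the
    other one covers beyond it is left to a pair inserted further on. No covered point is lost, and
    the number of pairs grows by exactly one. *)
Fixpoint insert_pair (b : nat) (D : seq nat) : seq nat :=
  if D is a :: D' then
    if (b.+1 < a)%N then b :: D
    else if b.+1 == a then b :: insert_pair b.+2 D'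
    else a :: insert_pair (maxn b a.+2) D'
  else [:: b].

Lemma size_insert_pair b D : size (insert_pair b D) = (size D).+1.
Proof. by elim: D b => //= a D IH b; do 2?case: ifP => _ //=; rewrite IH. Qed.

Lemma gapped_insert_pair s b D :
  (s <= b)%N -> gapped s D -> gapped s (insert_pair b D).
Proof.
elim: D s b => /= [s b ->//|a D IH s b sb /andP[sa gD]].
case: ifP => [h|h1]; first by rewrite /= sb gD; lia.
case: ifP => [h|h2] /=; rewrite ?sb ?sa /=.
  by apply: IH => //; apply: gapped_weak gD; lia.
by apply: IH => //; lia.
Qed.

Lemma in_pairs_insert b D x :
  (x == b) || (x == b.+1) || in_pairs D x -> in_pairs (insert_pair b D) x.
Proof.
elim: D b => //= a D IH b; rewrite /in_pairs /= -!/(in_pairs _ _).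
case: ifP => [h|h1]; first by rewrite /in_pairs /= -!/(in_pairs _ _).
case: ifP => [h|h2] /=; rewrite /in_pairs /= -!/(in_pairs _ _) => H.
  case: eqP => //= x1; case: eqP => //= x2; apply: IH.
  by lia.
case: eqP => //= x1; case: eqP => //= x2; apply: IH.
by lia.
Qed.

Lemma covered_insert s b D x :
  (x == b) || (x == b.+1) || covered s D x ->
  covered s (insert_pair (maxn s b) D) x.
Proof.
rewrite /covered; case: (ltnP x s) => //= sx H; apply: in_pairs_insert.
by lia.
Qed.

(** Overlapping pairs would give multiple roots, which P_n forbids. Successive insertion replaces
    them by disjoint ones and pads their number to exactly r. *)
Lemma gapped_cover s (B : seq nat) r : (size B <= r)%N ->
  exists D, [/\ gapped s D, size D = r &
    forall x, covered s B x -> covered s D x].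
Proof.
elim: B r => [|b B IH] r /=.
  elim: r => [_|r IH _]; first by exists [::].
  have [D [gD sD cD]] := IH isT; exists (insert_pair (maxn s 0) D).
  split; first by apply: gapped_insert_pair; lia.
    by rewrite size_insert_pair sD.
  by move=> x /cD h; apply: covered_insert; rewrite h orbT.
case: r => // r; rewrite ltnS => /IH[D [gD sD cD]].
exists (insert_pair (maxn s b) D); split.
- by apply: gapped_insert_pair => //; lia.
- by rewrite size_insert_pair sD.
- move=> x h; apply: covered_insert; move: h.
  rewrite /covered /in_pairs /= -!/(in_pairs _ _) => h.
  by have := cD x; rewrite /covered; lia.
Qed.

(* Greedy covering: the pair of the smallest uncovered point is always taken. *)
Lemma greedy_cover (S : pred nat) k s :
  (exists D, [/\ gapped s D, size D = k &
     forall x, S x -> covered s D x]) \/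
  (exists t, [/\ gapped s t, size t = k.+1 & all S t]).
Proof.
elim: k s => [|k IH] s.
  case: (pselect (exists x, S x && (s <= x)%N)) => [[x /andP[Sx sx]]|nS].
    by right; exists [:: x] => /=; rewrite Sx sx.
  left; exists [::]; split=> // x Sx; rewrite /covered ltnNge.
  by case: leqP => // sx; case: nS; exists x; rewrite Sx.
case: (pselect (exists x, S x && (s <= x)%N)) => [ex|nS]; last first.
  left; have [D [gD sD _]] := @gapped_cover s [::] k.+1 isT.
  exists D; split=> // x Sx; rewrite /covered ltnNge.
  by case: leqP => // sx; case: nS; exists x; rewrite Sx.
have [a /andP[Sa sa] amin] := ex_minnP ex.
case: (IH a.+2) => [[D [gD sD cD]]|[t [gt st At]]].
  left; exists (a :: D) => /=; rewrite sa gD sD; split=> // x Sx.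
  have := cD x Sx; rewrite /covered /in_pairs /= -!/(in_pairs _ _).
  case: (ltnP x s) => //= sx.
  by have := amin x; rewrite Sx sx => /(_ isT); lia.
by right; exists (a :: t) => /=; rewrite sa gt st Sa.
Qed.

(** * Products of pairs and finitely supported measures *)

Section PairPolynomials.
Variable R : realType.
Implicit Types (P G : {poly R}) (p : nat -> R) (m : seq R).

Definition pairpoly (s : nat) (D : seq nat) : {poly R} :=
  'X^s * \prod_(a <- D) (('X - a%:R%:P) * ('X - a.+1%:R%:P)).

Lemma horner_pairpoly s D (x : R) :
  (pairpoly s D).[x] = x ^+ s * \prod_(a <- D) ((x - a%:R) * (x - a.+1%:R)).
Proof.
rewrite /pairpoly hornerM hornerXn horner_prod; congr (_ * _).
by apply: eq_bigr => a _; rewrite !hornerE.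
Qed.

Lemma pair_ge0 (a x : nat) : 0 <= (x%:R - a%:R) * (x%:R - a.+1%:R) :> R.
Proof.
case: (leqP x a) => h.
  by apply: mulr_le0; rewrite subr_le0 ler_nat; lia.
by apply: mulr_ge0; rewrite subr_ge0 ler_nat; lia.
Qed.

Lemma pair_eq0 (a x : nat) :
  ((x%:R - a%:R) * (x%:R - a.+1%:R) == 0 :> R) = (x == a) || (x == a.+1).
Proof. by rewrite mulf_eq0 !subr_eq0 !eqr_nat. Qed.

Lemma pairpoly_ge0 s D (x : nat) : 0 <= (pairpoly s D).[x%:R].
Proof.
rewrite horner_pairpoly mulr_ge0 ?exprn_ge0 ?ler0n//.
by apply: prodr_ge0 => a _; apply: pair_ge0.
Qed.

Lemma pairpoly_eq0 s D (x : nat) : (s <= 1)%N ->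
  ((pairpoly s D).[x%:R] == 0) = covered s D x.
Proof.
move=> s1; rewrite horner_pairpoly mulf_eq0 expf_eq0 pnatr_eq0 /covered.
congr (_ || _); first by lia.
elim: D => [|a D IH]; first by rewrite big_nil oner_eq0.
by rewrite big_cons mulf_eq0 pair_eq0 IH.
Qed.

Lemma pairpoly_monic s D : pairpoly s D \is monic.
Proof.
rewrite /pairpoly monicMl ?monicXn// monic_prod// => a _.
by rewrite monicMl monicXsubC.
Qed.

Lemma size_pairpoly s D : size (pairpoly s D) = (2 * size D + s).+1.
Proof.
rewrite /pairpoly; elim: D => [|a D IH].
  by rewrite big_nil mulr1 size_polyXn /= muln0.
have mP := pairpoly_monic s D; rewrite /pairpoly in mP.
rewrite big_cons mulrCA size_Mmonic ?mulf_neq0 ?polyXsubC_eq0//.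
rewrite size_Mmonic ?monicXsubC ?polyXsubC_eq0// !size_XsubC IH /=; lia.
Qed.

Lemma Pclass_pairpoly s D : (s <= 1)%N -> gapped s D ->
  Pclass (2 * size D + s) (pairpoly s D).
Proof.
move=> s1 gD; split.
- exact: pairpoly_monic.
- exact: size_pairpoly.
- exists (nseq s 0 ++ flatten [seq [:: a; a.+1] | a <- D])%N; split.
  + have uF t D' : gapped t D' -> uniq (flatten [seq [:: a; a.+1] | a <- D']) /\
        {in flatten [seq [:: a; a.+1] | a <- D'], forall x, (t <= x)%N}.
      elim: D' t => //= a D' IH t /andP[ta gD']; have [u1 u2] := IH _ gD'.
      split; last first.
        by move=> x; rewrite !inE => /or3P[/eqP->|/eqP->|/u2]; lia.
      rewrite u1 andbT inE !negb_or.
      have -> : a \notin flatten [seq [:: a; a.+1] | a <- D'].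
        by apply/negP => /u2; lia.
      have -> : a.+1 \notin flatten [seq [:: a; a.+1] | a <- D'].
        by apply/negP => /u2; lia.
      by rewrite !andbT; lia.
    have [u1 u2] := uF _ _ gD.
    rewrite cat_uniq u1 andbT; apply/andP; split; first by case: (s) s1 => [|[]].
    apply/hasPn => x /u2; rewrite mem_nseq; lia.
  + rewrite size_cat size_nseq; clear gD; elim: D => //= [|a D IH]; lia.
  + move=> x H; rewrite /root pairpoly_eq0 // /covered.
    move: H; rewrite mem_cat mem_nseq => /orP[|/flattenP[l /mapP[a aD ->]]].
      lia.
    rewrite !inE => xa; rewrite orbC; apply/orP; left.
    by apply/hasP; exists a.
- exact: pairpoly_ge0.
Qed.

(** * Integration against finitely supported weights *)

Definition intw (K : nat) p P : R := \sum_(x < K) p x * P.[x%:R].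

Lemma intwD K p P G : intw K p (P + G) = intw K p P + intw K p G.
Proof. by rewrite /intw -big_split; apply: eq_bigr => x _; rewrite hornerD mulrDr. Qed.

Lemma intwZ K p c P : intw K p (c *: P) = c * intw K p P.
Proof. by rewrite /intw mulr_sumr; apply: eq_bigr => x _; rewrite hornerZ mulrCA. Qed.

Lemma intw_sum K p (I : Type) (r : seq I) (F : I -> {poly R}) :
  intw K p (\sum_(i <- r) F i) = \sum_(i <- r) intw K p (F i).
Proof.
elim: r => [|i r IH]; last by rewrite !big_cons intwD IH.
by rewrite !big_nil /intw big1// => x _; rewrite horner0 mulr0.
Qed.

Lemma intw_ge0 K p P : (forall x, 0 <= p x) ->
  (forall x : nat, p x != 0 -> 0 <= P.[x%:R]) -> 0 <= intw K p P.
Proof.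
move=> p0 P0; apply: sumr_ge0 => x _.
by have [->|/P0 h] := eqVneq (p x) 0; [rewrite mul0r|apply: mulr_ge0].
Qed.

Lemma intw_eq0 K p P : (forall x, 0 <= p x) ->
  (forall x, (K <= x)%N -> p x = 0) ->
  (forall x : nat, p x != 0 -> 0 <= P.[x%:R]) -> intw K p P = 0 ->
  forall x, p x != 0 -> P.[x%:R] = 0.
Proof.
move=> p0 pK P0 /eqP; rewrite psumr_eq0 => [|x _]; last first.
  by have [->|/P0 h] := eqVneq (p x) 0; [rewrite mul0r|apply: mulr_ge0].
move=> /allP H x px; have [Kx|xK] := leqP K x; first by rewrite pK ?eqxx in px.
have := H (Ordinal xK); rewrite mem_index_enum /= => /(_ isT).
by rewrite mulf_eq0 (negbTE px) => /eqP.
Qed.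

Lemma intw_null K p P : (forall x, p x != 0 -> P.[x%:R] = 0) ->
  intw K p P = 0.
Proof.
move=> H; apply: big1 => x _.
by have [->|/H->] := eqVneq (p x) 0; rewrite ?mul0r ?mulr0.
Qed.

Definition wrealizes p K m : Prop :=
  [/\ forall x, 0 <= p x, forall x, (K <= x)%N -> p x = 0 &
   forall k, (k <= size m)%N -> intw K p 'X^k = mom m k].

Lemma Lfun_intw p K m P : wrealizes p K m -> (size P <= (size m).+1)%N ->
  Lfun P m = intw K p P.
Proof.
move=> [_ _ Hm] sP.
have -> : P = \sum_(k < (size m).+1) P`_k *: 'X^k.
  rewrite -[LHS]coefK [LHS]poly_def.
  rewrite (big_ord_widen _ (fun i => P`_i *: 'X^i) sP) big_mkcond.
  apply: eq_bigr => i _; case: ltnP => // h; by rewrite nth_default ?scale0r.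
rewrite intw_sum /Lfun; apply: eq_bigr => i _; rewrite intwZ Hm -1?ltnS//.
congr (_ * _); rewrite coef_sum (bigD1 i)//= coefZ coefXn eqxx mulr1.
rewrite big1 ?addr0// => j ji; rewrite coefZ coefXn.
by rewrite eq_sym (inj_eq val_inj) (negbTE ji) mulr0.
Qed.

Lemma mom0 m : mom m 0 = 1. Proof. by []. Qed.

Lemma mom_rcons m c k : (k <= size m)%N -> mom (rcons m c) k = mom m k.
Proof. by case: k => //= k; rewrite /mom /= nth_rcons => ->. Qed.

Lemma mom_rcons_last m c : mom (rcons m c) (size m).+1 = c.
Proof. by rewrite /mom /= nth_rcons ltnn eqxx. Qed.

(** Since P is monic, the last moment enters as an additive constant, so comparing two such
    polynomials does not depend on it. *)
Lemma Lfun_rcons m c P : P \is monic -> size P = (size m).+2 ->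
  Lfun P (rcons m c) = \sum_(k < (size m).+1) P`_k * mom m k + c.
Proof.
move=> mP sP; rewrite /Lfun size_rcons big_ord_recr /= mom_rcons_last.
congr (_ + _); last by move/monicP: mP; rewrite lead_coefE sP /= => ->; rewrite mul1r.
by apply: eq_bigr => i _; rewrite mom_rcons// -ltnS.
Qed.

(** Positivity is asked at the polynomials [pairpoly s D] of degree [size m] or [size m] - 1; in
    this form the condition is inherited by M_l(m). *)
Definition Ireal m : Prop := forall s D, (s <= 1)%N -> gapped s D ->
  (2 * size D + s == size m) || ((2 * size D + s).+1 == size m) ->
  0 < Lfun (pairpoly s D) m.

Lemma I_realizable_Ireal m : (1 <= size m)%N -> I_realizable m -> Ireal m.
Proof.
move=> m1 [_ H] s D s1 gD /orP[/eqP e|/eqP e]; apply: H; [left|right].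
  by rewrite -e; apply: Pclass_pairpoly.
by rewrite -e; apply: Pclass_pairpoly.
Qed.

(* I-realizability bounds the index of the support from below. *)
Lemma Ireal_uncovered m p K s (B : seq nat) r : wrealizes p K m -> Ireal m ->
  (s <= 1)%N -> (size B <= r)%N ->
  (2 * r + s == size m) || ((2 * r + s).+1 == size m) ->
  exists2 x, p x != 0 & ~~ covered s B x.
Proof.
move=> wp Im s1 Br er; apply: contrapT => Hn.
have [D [gD sD cD]] := gapped_cover s Br.
have := Im s D s1 gD; rewrite sD => /(_ er).
rewrite (Lfun_intw wp) ?size_pairpoly ?sD; last by lia.
rewrite intw_null ?ltxx// => x px; apply/eqP; rewrite pairpoly_eq0//.
by apply: cD; apply: contrapT => /negP h; apply: Hn; exists x.
Qed.

End PairPolynomials.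

(** * Perturbation along a divided difference *)

Section Perturbation.
Variable R : realType.
Implicit Types (P G : {poly R}) (p : nat -> R) (m : seq R).

(** For distinct nodes c and x among them, this is the derivative at x of the product of all X - y;
    its inverse is the weight of x in the divided difference over c. *)
Definition node_prod (c : seq nat) (x : nat) : R :=
  \prod_(y <- c | y != x) (x%:R - y%:R).

Lemma node_prod_neq0 c x : node_prod c x != 0.
Proof.
rewrite /node_prod prodf_seq_neq0; apply/allP => y _; apply/implyP => yx.
by rewrite subr_eq0 eqr_nat eq_sym.
Qed.

(* Compare the leading coefficients in the Lagrange interpolation of X^j. *)
Lemma divided_difference_Xn (c : seq nat) j : uniq c -> (j < size c)%N ->
  \sum_(x <- c) (node_prod c x)^-1 * x%:R ^+ j = (j.+1 == size c)%:R.
Proof.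
move=> uc jc.
pose l x : {poly R} := \prod_(y <- c | y != x) ('X - y%:R%:P).
have ml x : l x \is monic by apply: monic_prod => y _; apply: monicXsubC.
have sl x : x \in c -> size (l x) = size c.
  move=> xc; rewrite /l -big_filter size_prod_XsubC size_filter.
  have := count_predC (pred1 x) c; rewrite count_uniq_mem// xc add1n => <-.
  by congr _.+1; apply: eq_count.
pose L := \sum_(x <- c) ((node_prod c x)^-1 * x%:R ^+ j) *: l x.
have hl x z : z \in c -> (l x).[z%:R] = if z == x then node_prod c x else 0.
  move=> zc; rewrite /l horner_prod; case: eqP => [->|/eqP zx].
    by apply: eq_bigr => y _; rewrite !hornerE.
  apply/eqP; rewrite prodf_seq_eq0; apply/hasP.
  by exists z; rewrite ?zx// !hornerE subrr.
have EL : 'X^j - L = 0.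
  apply: (@roots_geq_poly_eq0 _ _ [seq (x%:R : R) | x <- c]).
  - apply/allP => _ /mapP[z zc ->]; rewrite /root /L hornerD hornerN hornerXn.
    rewrite horner_sum (bigD1_seq z)//= hornerZ hl// eqxx mulrAC mulVf.
      rewrite mul1r big1 ?addr0 ?subrr// => y yz.
      by rewrite hornerZ hl// eq_sym (negbTE yz) mulr0.
    exact: node_prod_neq0.
  - by rewrite map_inj_uniq// => a b /eqP; rewrite eqr_nat => /eqP.
  - rewrite size_map; apply: leq_trans (size_polyD _ _) _.
    rewrite geq_max size_polyXn jc size_polyN.
    apply: leq_trans (size_sum _ _ _) _; apply/bigmax_leqP_seq => x xc _.
    by apply: leq_trans (size_scale_leq _ _) _; rewrite sl.
have c0 : (0 < size c)%N by case: (size c) jc.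
have := congr1 (fun P : {poly R} => P`_(size c).-1) EL.
rewrite /= coef0 coefB coefXn /L coef_sum => /eqP; rewrite subr_eq0 => /eqP e.
rewrite -[in RHS](prednK c0) eqSS eq_sym e big_seq [RHS]big_seq.
apply: eq_bigr => x xc; rewrite coefZ; have := ml x.
by rewrite monicE lead_coefE sl// => /eqP ->; rewrite mulr1.
Qed.

Definition node_block (e b : nat) : seq nat := nseq e b.-1 ++ [:: b].

(** To the left of a two-point block both factors are negative, and from b on those present are
    positive. Only at b - 1 is the product negative. *)
Lemma node_block_gt0 e b x : (e <= 1)%N -> (e <= b)%N ->
  (b <= x)%N \/ (e = 1%N /\ (x.+2 <= b)%N) -> 0 < node_prod (node_block e b) x.
Proof.
move=> e1 eb; rewrite /node_prod /node_block.
case: e e1 eb => [|[]]//= _ eb h; rewrite !big_cons big_nil.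
  by case: ifP => bx; rewrite ?mulr1 ?subr_gt0 ?ltr01 ?ltr_nat; lia.
case: h => [h|[_ h]].
  by case: ifP => bx; case: ifP => bx';
     rewrite ?mulr1 ?mulr_gt0 ?subr_gt0 ?ltr01 ?ltr_nat; lia.
do 2![rewrite ifT; last by lia].
by rewrite mulr1 nmulr_rgt0 subr_lt0 ltr_nat; lia.
Qed.

Lemma node_block_lt0 b : (0 < b)%N -> node_prod (node_block 1 b) b.-1 < 0.
Proof.
move=> b0; rewrite /node_prod /node_block /= !big_cons big_nil eqxx.
by rewrite ifT ?mulr1 ?subr_lt0 ?ltr_nat; lia.
Qed.

(** Each point brings its left neighbour, except that the first does so only for s = 1. Thus k + 1
    points yield 2k + s + 1 nodes, as a divided difference of order 2k + s requires. *)
Definition chain_nodes (s : nat) (t : seq nat) : seq nat :=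
  if t is a :: t' then node_block s a ++ flatten [seq node_block 1 b | b <- t']
  else [::].

Lemma node_prod_cat c c' x :
  node_prod (c ++ c') x = node_prod c x * node_prod c' x.
Proof. by rewrite /node_prod big_cat. Qed.

Lemma node_prod_flatten t x :
  node_prod (flatten [seq node_block 1 b | b <- t]) x =
  \prod_(b <- t) node_prod (node_block 1 b) x.
Proof.
elim: t => [|b t IH]; first by rewrite /node_prod !big_nil.
by rewrite big_cons -IH /= -node_prod_cat.
Qed.

Lemma size_chain_nodes s t : t != [::] ->
  size (chain_nodes s t) = (2 * (size t).-1 + s).+1.
Proof.
case: t => //= a t _; rewrite !size_cat size_nseq /=.
have -> : size (flatten [seq node_block 1 b | b <- t]) = (2 * size t)%N.
  by elim: t => //= b t IH; rewrite IH; lia.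
lia.
Qed.

Lemma mem_flatten_blocks t x :
  x \in flatten [seq node_block 1 b | b <- t] ->
  exists2 b, b \in t & (x == b.-1) || (x == b).
Proof.
move=> /flattenP[l /mapP[b bt ->]]; rewrite /node_block !inE => h.
by exists b.
Qed.

Lemma mem_chain_nodes s t x : gapped s t -> x \in chain_nodes s t ->
  exists2 b, b \in t & (x == b.-1) || (x == b).
Proof.
case: t => //= a t /andP[sa gt]; rewrite mem_cat => /orP[|].
  rewrite /node_block mem_cat mem_nseq inE => h.
  by exists a; rewrite ?mem_head//; lia.
by move=> /mem_flatten_blocks[b bt h]; exists b => //; rewrite inE bt orbT.
Qed.

Lemma uniq_chain_nodes s t : (s <= 1)%N -> gapped s t ->
  uniq (chain_nodes s t).
Proof.
move=> s1; case: t => //= a t /andP[sa gt].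
have ub e b : (e <= 1)%N -> (e <= b)%N -> uniq (node_block e b).
  by case: e => [|[]]//= _ h; rewrite inE andbT; lia.
rewrite cat_uniq ub//=; apply/andP; split.
  apply/hasPn => x /mem_flatten_blocks[b bt h].
  rewrite /node_block mem_cat mem_nseq inE; have := gapped_ge gt bt; lia.
elim: t {sa} (a.+2) gt (erefl : (1 < a.+2)%N) => //= b t IH c /andP[cb gt] c1.
rewrite (IH b.+2)// !andbT inE negb_or -andbA; apply/and3P; split; first by lia.
- by apply/negP => /mem_flatten_blocks[d dt h]; have := gapped_ge gt dt; lia.
- by apply/negP => /mem_flatten_blocks[d dt h]; have := gapped_ge gt dt; lia.
Qed.

(** A node outside t is the left neighbour of some b in t: the block of b contributes a negative
    factor, all other blocks positive ones. *)
Lemma chain_nodes_lt0 s t x : (s <= 1)%N -> gapped s t ->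
  x \in chain_nodes s t -> x \notin t -> node_prod (chain_nodes s t) x < 0.
Proof.
move=> s1; case: t => // a t gat; have /= /andP[sa gt] := gat.
rewrite mem_cat inE negb_or => xc /andP[xa xt].
rewrite node_prod_cat node_prod_flatten; case/orP: xc => [|].
  rewrite {1}/node_block mem_cat mem_nseq inE (negbTE xa) orbF => /andP[s0 /eqP xE].
  have es : s = 1%N by lia.
  rewrite pmulr_llt0; first by rewrite xE es node_block_lt0; lia.
  rewrite big_seq; apply: prodr_gt0 => b bt; have := gapped_ge gt bt => ab.
  by apply: node_block_gt0 => //; [lia|right; lia].
move=> /mem_flatten_blocks[b bt h]; have := gapped_ge gt bt => ab.
have xE : x = b.-1.
  by case/orP: h => /eqP// e; rewrite e bt in xt.
rewrite pmulr_rlt0; last by apply: node_block_gt0 => //; left; lia.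
rewrite (bigD1_seq b)//=; last exact: gapped_uniq gt.
rewrite pmulr_llt0; first by rewrite xE; apply: node_block_lt0; lia.
rewrite big_seq_cond; apply: prodr_gt0 => d /andP[dt db].
have := gapped_ge gt dt => ad.
apply: node_block_gt0 => //; first by lia.
case: (gapped_sep gt bt dt) => h'; [by rewrite h' eqxx in db|right|left]; lia.
Qed.

Lemma small_multiple p (w : nat -> R) (t : seq nat) :
  {in t, forall x, 0 < p x} ->
  exists2 e, 0 < e & {in t, forall x, e * w x <= p x}.
Proof.
elim: t => [|a t IH] H; first by exists 1.
have [|e e0 He] := IH; first by move=> x xt; apply: H; rewrite inE xt orbT.
have pa : 0 < p a by apply: H; rewrite mem_head.
pose d := p a / (`|w a| + 1).
have w1 : 0 < `|w a| + 1 by rewrite ltr_wpDl.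
have d0 : 0 < d by rewrite divr_gt0.
exists (Num.min e d); first by rewrite lt_min e0.
move=> x; rewrite inE => /orP[/eqP->|xt].
  apply: (@le_trans _ _ (Num.min e d * (`|w a| + 1))).
    rewrite ler_wpM2l//; first by rewrite ltW// lt_min e0.
    by rewrite (le_trans (ler_norm _))// lerDl.
  by rewrite -ler_pdivlMr// ge_min lexx orbT.
have [wx|wx] := leP (w x) 0.
  rewrite (@le_trans _ _ 0)//; last by apply/ltW/H; rewrite inE xt orbT.
  by apply: mulr_ge0_le0 => //; rewrite ltW// lt_min e0.
by apply: le_trans (He _ xt); rewrite ler_pM2r// ge_min lexx.
Qed.

(* Moving mass along the divided difference of X^(2k+s) at the points of the
   chain and their left neighbours lowers the highest moment: the points that
   lose mass are those of the chain. *)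
Lemma chain_perturbation p K s (t : seq nat) k : (forall x, 0 <= p x) ->
  (s <= 1)%N -> gapped s t -> size t = k.+1 ->
  {in t, forall x, p x != 0} -> {in t, forall x, (x < K)%N} ->
  exists h : nat -> R, [/\ forall x, 0 <= p x + h x,
    forall x, (K <= x)%N -> h x = 0,
    forall j, (j < 2 * k + s)%N -> intw K h 'X^j = 0 &
    intw K h 'X^(2 * k + s) < 0].
Proof.
move=> p0 s1 gt st pt tK; set c := chain_nodes s t.
have t0 : t != [::] by case: (t) st.
have uc : uniq c by apply: uniq_chain_nodes.
have sc : size c = (2 * k + s).+1 by rewrite size_chain_nodes// st.
pose w x : R := if x \in c then (node_prod c x)^-1 else 0.
have [|e e0 He] := @small_multiple p w t.
  by move=> x xt; rewrite lt_neqAle eq_sym pt//=.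
have cK x : x \in c -> (x < K)%N.
  by move=> /(mem_chain_nodes gt)[b /tK bK h]; lia.
have Iw j : (j < size c)%N -> intw K w 'X^j = (j.+1 == size c)%:R.
  move=> jc; rewrite -divided_difference_Xn// /intw.
  rewrite -(big_mkord xpredT (fun x => w x * ('X^j).[x%:R])).
  rewrite (bigID (fun x => x \in c))/= [X in _ + X]big1 ?addr0; last first.
    by move=> x /negbTE xc; rewrite /w xc mul0r.
  rewrite -big_filter; rewrite [RHS](perm_big [seq x <- index_iota 0 K | x \in c])/=.
    rewrite !big_filter; apply: eq_bigr => x xc.
    by rewrite /w xc hornerXn.
  apply: uniq_perm => //; first by rewrite filter_uniq// iota_uniq.
  by move=> x; rewrite mem_filter mem_index_iota; case: (boolP (x \in c)) => //= /cK.
have Ih j : intw K (fun x => - (e * w x)) 'X^j = - e * intw K w 'X^j.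
  by rewrite /intw mulr_sumr; apply: eq_bigr => x _; ring.
exists (fun x => - (e * w x)); split.
- move=> x; rewrite subr_ge0; have [xt|xt] := boolP (x \in t); first exact: He.
  rewrite (le_trans _ (p0 x))// mulr_ge0_le0// ?(ltW e0)// /w.
  by case: ifP => // xc; rewrite invr_le0 ltW// chain_nodes_lt0.
- move=> x Kx; rewrite /w ifF ?mulr0 ?oppr0//; apply/negP => /cK; lia.
- by move=> j jk; rewrite Ih Iw sc ?eqSS ?ltn_eqF ?mulr0//; lia.
- by rewrite Ih Iw sc ?eqxx ?mulr1 ?oppr_lt0.
Qed.

End Perturbation.

(** * Existence of minimal measures *)

Section MinimalMeasure.
Variable R : realType.
Implicit Types (P G : {poly R}) (p : nat -> R) (m : seq R).

(** Minimality of the n-th moment, n = [size m] + 1, is replaced by a condition on the support: some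
    [pairpoly] of degree n vanishes on it. This condition passes directly to the tilted weights of
    the recursion. *)
Definition index_minimal p K m : Prop :=
  wrealizes p K m /\ exists D, [/\ gapped (odd (size m).+1) D,
    size D = (size m).+1./2 &
    forall x, p x != 0 -> covered (odd (size m).+1) D x].

Lemma continuous_row_sum n (c : 'I_n -> R) :
  continuous (fun v : 'rV[R]_n => \sum_(i < n) v 0 i * c i).
Proof.
elim: (index_enum _) => [|i r IH] v.
  rewrite (_ : (fun=> _) = (fun=> 0)); first exact: cst_continuous.
  by apply/funext => w; rewrite big_nil.
rewrite (_ : (fun=> _) = (fun w : 'rV[R]_n =>
    w 0 i * c i + \sum_(j <- r) w 0 j * c j)); last first.
  by apply/funext => w; rewrite big_cons.
have h : {for v, continuous (fun w : 'rV[R]_n => w 0 i)}.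
  exact: coord_continuous.
exact: (cvgD (cvgMr_tmp h) (IH v)).
Qed.

Definition weight_of_row n (v : 'rV[R]_n) (x : nat) : R :=
  if insub x is Some i then v 0 i else 0.

Lemma intw_weight_of_row n (v : 'rV[R]_n) P :
  intw n (weight_of_row v) P = \sum_(i < n) v 0 i * P.[i%:R].
Proof.
apply: eq_bigr => i _; rewrite /weight_of_row.
case: insubP => [j _ ji|]; last by rewrite ltn_ord.
by congr (v 0 _ * _); apply: val_inj.
Qed.

(** The weights on {0, ..., K - 1} with the given moments form a closed subset of the simplex, hence
    a compact set, on which the n-th moment is continuous. *)
Lemma exists_minimal p K m : wrealizes p K m ->
  exists2 q, wrealizes q K m &
  forall r, wrealizes r K m ->
    intw K q 'X^((size m).+1) <= intw K r 'X^((size m).+1).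
Proof.
move=> wp.
pose A : set 'rV[R]_K :=
  ((\bigcap_(i in [set: 'I_K]) (fun v : 'rV[R]_K => v 0 i) @^-1` [set y | 0 <= y]) `&`
  (\bigcap_(k in [set k | (k <= size m)%N])
    (fun v : 'rV[R]_K => \sum_(i < K) v 0 i * ('X^k).[i%:R]) @^-1`
       [set y | y = mom m k]))%classic.
have Aw v : A v -> wrealizes (weight_of_row v) K m.
  move=> [Av1 Av2]; split.
  - by move=> x; rewrite /weight_of_row; case: insubP => // i _ _; apply: Av1.
  - by move=> x Kx; rewrite /weight_of_row insubF// ltnNge Kx.
  - by move=> k km; rewrite intw_weight_of_row; apply: Av2.
have wA r : wrealizes r K m -> A (\row_(i < K) r i).
  move=> [r1 r2 r3]; split=> [i _|k km] /=; first by rewrite mxE.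
  by rewrite -r3//; apply: eq_bigr => i _; rewrite mxE.
have cA : closed A.
  apply: closedI; apply: closed_bigI => i _; apply: preimage_closed.
  - by move=> v _; apply: coord_continuous.
  - exact: closed_ge.
  - by move=> v _; apply: continuous_row_sum.
  - exact: closed_eq.
have bA : bounded_set A.
  exists 1; split; first exact: num_real.
  move=> M M1 v Av; have [v1 v2] := Av.
  have vs : \sum_(i < K) v 0 i = 1.
    have := v2 0%N isT; rewrite /= mom0 => <-.
    by apply: eq_bigr => i _; rewrite hornerXn expr0 mulr1.
  have M0 : 0 < M by apply: lt_trans M1.
  rewrite /= [leLHS]/Num.Def.normr/= mx_normrE (bigmax_le _ (ltW M0))//=.
  move=> [i j] _ /=; rewrite (ord1 i) ger0_norm; last exact: v1.

  rewrite (le_trans _ (ltW M1))// -vs (bigD1 j)//= lerDl.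
  by apply: sumr_ge0 => l _; apply: v1.
have := @EVT_min_rV R K
  (fun v => \sum_(i < K) v 0 i * ('X^((size m).+1)).[i%:R]) A.
case.
- by exists (\row_(i < K) p i); apply: wA.
- exact: bounded_closed_compact.
- by apply: continuous_subspaceT; apply: continuous_row_sum.
move=> v /set_mem Av vmin; exists (weight_of_row v); first exact: Aw.
move=> r wr; rewrite intw_weight_of_row.
have := vmin _ (mem_set (wA _ wr)) => /le_trans; apply.
by rewrite le_eqVlt; apply/orP; left; apply/eqP; apply: eq_bigr => i _; rewrite mxE.
Qed.

(** Minimality among the weights below K is enough: the nodes of the perturbation do not exceed the
    points of the chain, so a chain of k + 1 points in the support would allow a smaller n-th moment
    below the same K. *)
Lemma exists_index_minimal p K m : wrealizes p K m ->
  exists q, index_minimal q K m.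
Proof.
move=> /exists_minimal[q wq qmin]; exists q; split => //.
have [q0 qK qm] := wq; set n := (size m).+1.
have en : (odd n + 2 * n./2)%N = n by rewrite mul2n odd_double_half.
case: (greedy_cover (fun x => q x != 0) n./2 (odd n)) => [|[t [gt st At]]]//.
have qt : {in t, forall x, q x != 0} by apply/allP.
have tK : {in t, forall x, (x < K)%N}.
  by move=> x /qt; apply: contraNT; rewrite -leqNgt => /qK/eqP.
have [h [h1 h2 h3 h4]] := chain_perturbation q0 (leq_b1 _) gt st qt tK.
have hD P : intw K (fun x => q x + h x) P = intw K q P + intw K h P.
  by rewrite /intw -big_split; apply: eq_bigr => x _; rewrite mulrDl.
have : wrealizes (fun x => q x + h x) K m.
  split=> // [x Kx|k km]; first by rewrite qK// h2// addr0.
  by rewrite hD qm// h3 ?addr0//; rewrite addnC en.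
move=> /qmin; rewrite hD -subr_ge0 addrAC subrr add0r -/n -{1}en addnC.
by rewrite leNgt h4.
Qed.

End MinimalMeasure.

(** * Polynomials with prescribed signs *)

Section SignPolynomials.
Variable R : realType.
Implicit Types (F P G : {poly R}).

Lemma root_full_list P (l : seq R) : P != 0 -> (size P <= (size l).+1)%N ->
  uniq l -> all (root P) l -> forall x, root P x = (x \in l).
Proof.
move=> P0 sP ul rl x; apply/idP/idP => [rx|xl]; last exact: (allP rl).
apply: contraT => xl.
suff : (size (x :: l) < size P)%N by move=> /leq_trans/(_ sP); rewrite ltnn.
by apply: max_poly_roots => //=; rewrite ?rx ?xl.
Qed.

(* The list l consists of the roots of odd multiplicity. *)
Lemma sign_change_roots F : F != 0 -> exists (l : seq R) (e : R),
  [/\ e != 0, uniq l, all (root F) l &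
      forall x, 0 <= e * (F * \prod_(z <- l) ('X - z%:P)).[x]].
Proof.
move: {2}(size F) (leqnn (size F)) => n; elim: n F => [|n IH] F sF F0.
  by move: F0; rewrite -size_poly_gt0; lia.
case: (pselect (exists z, root F z)) => [[z rz]|nr]; last first.
  exists [::], F.[0]; split=> //.
    by apply/negP => h; apply: nr; exists 0.
  move=> x; rewrite big_nil mulr1 leNgt; apply/negP => h; apply: nr.
  have [x0|x0] := leP 0 x.
    by have [z _ rz] := poly_ivtoo x0 h; exists z.
  by rewrite mulrC in h; have [z _ rz] := poly_ivtoo (ltW x0) h; exists z.
have [F' FE] := factor_theorem F z rz.
have F'0 : F' != 0 by apply: contraNneq F0 => e; rewrite FE e mul0r.
have sF' : (size F' <= n)%N.
  by move: sF; rewrite FE size_Mmonic ?monicXsubC// size_XsubC addn2.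
have [l [e [e0 ul rl H]]] := IH _ sF' F'0.
(* Restoring the factor X - z flips the parity of the multiplicity of z, so z leaves the list if it
   is there and joins it otherwise. *)
have [zl|zl] := boolP (z \in l).
  exists (rem z l), e; split=> //; first exact: rem_uniq.
    apply/allP => x /mem_rem /(allP rl) rx.
    by rewrite FE rootM rx.
  move=> x; have := H x; rewrite (perm_big _ (perm_to_rem zl)) big_cons /=.
  by rewrite FE mulrA.
exists (z :: l), e; split=> //=; first by rewrite zl.
  by rewrite rz/=; apply/allP => x /(allP rl) rx; rewrite FE rootM rx.
move=> x; have := H x; rewrite big_cons FE !hornerM !hornerXsubC => Hx.
rewrite (_ : _ * _ = (x - z) ^+ 2 *
  (e * (F'.[x] * (\prod_(z <- l) ('X - z%:P)).[x]))); last by ring.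
by rewrite mulr_ge0// sqr_ge0.
Qed.

(** The pairs are treated from right to left; a change of sign between neighbouring pairs costs one
    linear factor with its root between them. The induction needs the sign [e a] on the whole
    half-line up to a + 1, since the next pair to be treated lies there. *)
Lemma gapped_sign_poly c a D (e : nat -> R) : gapped c (a :: D) ->
  (forall b, e b != 0) ->
  exists G, [/\ (size G <= size (a :: D))%N,
    forall x, x <= a.+1%:R -> 0 < e a * G.[x] &
    {in a :: D, forall b, 0 < e b * G.[b%:R] /\ 0 < e b * G.[b.+1%:R]}].
Proof.
move=> gD e0; have sq b : 0 < e b * e b by rewrite -expr2 exprn_even_gt0//= e0.
elim: D a c gD => [|b D IH] a c.
  move=> _; exists (e a)%:P; split=> [|x _|b]; rewrite ?hornerC//.
    by rewrite size_polyC e0.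
  by rewrite inE => /eqP->; rewrite ?hornerC.
move=> /= /andP[ca gD]; have [G [sG G1 G2]] := IH _ _ gD.
have /andP[ab gD'] := gD.
have abR : a%:R + 2 <= b%:R :> R by rewrite -natrD ler_nat addn2.
have [eab|eab] := ltP 0 (e a * e b).
  have h x : x <= a.+1%:R -> 0 < e a * G.[x].
    rewrite -natr1 => xa; have h1 : 0 < e b * G.[x].
      by apply: G1; rewrite -natr1; lra.
    rewrite -(pmulr_rgt0 _ (sq b)).
    rewrite (_ : e b * e b * _ = (e a * e b) * (e b * G.[x])); last by ring.
    exact: mulr_gt0.
  exists G; split=> //; first exact: leq_trans sG _.
  move=> d; rewrite inE => /orP[/eqP->|]; last exact: G2.
  by split; apply: h; rewrite ler_nat; lia.
have eab' : e a * e b < 0 by rewrite lt_neqAle eab mulf_neq0.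
(* Since b is at least a + 2, this t lies strictly between the pairs of a and b. *)
pose t : R := a%:R + 3 / 2.
have h x : x <= a.+1%:R -> 0 < e a * (G * ('X - t%:P)).[x].
  rewrite -natr1 => xa; have h1 : 0 < e b * G.[x].
    by apply: G1; rewrite -natr1; lra.
  have h2 : x - t < 0 by rewrite /t; lra.
  rewrite -(pmulr_rgt0 _ (sq b)) hornerM hornerXsubC.
  rewrite (_ : e b * e b * _ = (e a * e b) * (x - t) * (e b * G.[x])); last by ring.
  by rewrite mulr_gt0// nmulr_rgt0.
exists (G * ('X - t%:P)); split.
- by apply: leq_trans (size_polyMleq _ _) _; rewrite size_XsubC addn2.
- exact: h.
- move=> d; rewrite inE => /orP[/eqP->|dD].
    by split; apply: h; rewrite ler_nat; lia.
  have bd : b%:R <= d%:R :> R.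
    by rewrite ler_nat; move: dD; rewrite inE => /orP[/eqP->//|/(gapped_ge gD')]; lia.
  have [g1 g2] := G2 d dD; rewrite !hornerM !hornerXsubC !mulrA.
  have h1 : 0 < d%:R - t by rewrite /t; lra.
  have h2 : 0 < d.+1%:R - t by rewrite /t -natr1; lra.
  by split; apply: mulr_gt0.
Qed.

End SignPolynomials.

(** * The orthogonal polynomial *)

Section OrthogonalPolynomial.
Variables (R : realType) (m : seq R) (p : nat -> R) (K : nat).
Hypotheses (m1 : (0 < size m)%N) (wp : wrealizes p K m) (Im : Ireal m).
Implicit Types (P G : {poly R}).

Let s : nat := odd (size m).+1.
Let k : nat := (size m).+1./2.

(* Integration against the measure x^s p, for which nu_poly / X^s is
   orthogonal to all polynomials of smaller degree. *)
Let lam P : R := intw K p ('X^s * P).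

Let sizeE : (2 * k + s = (size m).+1)%N.
Proof. by rewrite addnC mul2n odd_double_half. Qed.

Let s1 : (s <= 1)%N. Proof. by rewrite /s; case: odd. Qed.

Let k0 : (0 < k)%N. Proof. by move: sizeE s1; lia. Qed.

Definition shifted_support : seq nat :=
  [seq x <- iota 0 K | (p x != 0) && (s <= x)%N].

Lemma mem_shifted_support x :
  (x \in shifted_support) = (p x != 0) && (s <= x)%N.
Proof.
have [_ pK _] := wp; rewrite mem_filter mem_iota /= add0n.
by case: ltnP => [_|/pK ->]; rewrite ?andbT ?andbF ?eqxx.
Qed.

Lemma uniq_shifted_support : uniq [seq (x%:R : R) | x <- shifted_support].
Proof.
rewrite map_inj_uniq ?filter_uniq ?iota_uniq//.
by move=> a b /eqP; rewrite eqr_nat => /eqP.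
Qed.

(** With fewer than k points, the pairs starting at them, together with 0 if s = 1, would carry p.
    They fit into k - 1 pairs, of degree 2(k - 1) + s = [size m] - 1, which [Ireal] excludes. *)
Lemma size_shifted_support : (k <= size shifted_support)%N.
Proof.
rewrite leqNgt; apply/negP => lk.
have [||x px] := @Ireal_uncovered _ m p K s shifted_support k.-1 wp Im s1.
- by rewrite -ltnS prednK.
- by apply/orP; right; move: sizeE k0; lia.
rewrite /covered negb_or -leqNgt => /andP[sx]; apply/negP/negPn/hasP.
by exists x; rewrite ?mem_shifted_support ?px ?eqxx.
Qed.

Lemma vanish_eq0 P : (size P <= k)%N ->
  {in shifted_support, forall x, P.[x%:R] = 0} -> P = 0.
Proof.
move=> sP H.
apply: (roots_geq_poly_eq0 (rs := [seq (x%:R : R) | x <- shifted_support])).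
- by apply/allP => _ /mapP[x xl ->]; apply/eqP/H.
- exact: uniq_shifted_support.
- by rewrite size_map (leq_trans sP)// size_shifted_support.
Qed.

Lemma lam_vanish P : (forall x, x \in shifted_support -> 0 <= P.[x%:R]) ->
  lam P = 0 -> {in shifted_support, forall x, P.[x%:R] = 0}.
Proof.
have [p0 pK _] := wp; move=> P0 lP x; rewrite mem_shifted_support => /andP[px sx].
have /eqP : ('X^s * P).[x%:R] = 0.
  apply: (intw_eq0 p0 pK _ lP) => // y py; rewrite hornerM hornerXn.
  have [ys|sy] := ltnP y s.
    have -> : (y%:R : R) ^+ s = 0; last by rewrite mul0r.
    by apply/eqP; rewrite expf_eq0 pnatr_eq0; move: s1; lia.
  by rewrite mulr_ge0 ?exprn_ge0// P0// mem_shifted_support py.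
rewrite hornerM hornerXn mulf_eq0 expf_eq0 pnatr_eq0.
by case/orP => [|/eqP//]; lia.
Qed.

Lemma lam_sum (I : Type) (r : seq I) (F : I -> {poly R}) :
  lam (\sum_(i <- r) F i) = \sum_(i <- r) lam (F i).
Proof. by rewrite /lam mulr_sumr intw_sum. Qed.

Lemma lamZ c P : lam (c *: P) = c * lam P.
Proof. by rewrite /lam -scalerAr intwZ. Qed.

Lemma lamXn j : (j + s <= size m)%N -> lam 'X^j = mom m (j + s).
Proof. by have [_ _ H] := wp; move=> h; rewrite /lam -exprD addnC H. Qed.

Lemma lam_orth P : (forall j, (j < k)%N -> lam (P * 'X^j) = 0) ->
  forall G, (size G <= k)%N -> lam (P * G) = 0.
Proof.
move=> H G sG; rewrite -[G]coefK poly_def mulr_sumr lam_sum big1// => i _.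
by rewrite -scalerAr lamZ H ?mulr0//; apply: leq_trans sG.
Qed.

Let lam_row (v : 'rV[R]_k) (j : 'I_k) :
  lam ((\sum_(i < k) v 0 i *: 'X^i) * 'X^j) = (v *m hankel s m k) 0 j.
Proof.
rewrite mulr_suml lam_sum !mxE; apply: eq_bigr => i _.
rewrite -scalerAl lamZ -exprD mxE lamXn//.
by have := ltn_ord i; have := ltn_ord j; move: sizeE; lia.
Qed.

(** A kernel vector is a polynomial P of degree < k orthogonal to itself; it vanishes on at least k
    points of the support, hence is 0. *)
Lemma hankel_unitmx : hankel s m k \in unitmx.
Proof.
rewrite -row_free_unit; apply: inj_row_free => v vH.
set P := \sum_(i < k) v 0 i *: 'X^i.
have sP : (size P <= k)%N.
  apply: leq_trans (size_sum _ _ _) _; apply/bigmax_leqP => i _.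
  by apply: leq_trans (size_scale_leq _ _) _; rewrite size_polyXn.
have PP : lam (P * P) = 0.
  apply: lam_orth sP => j jk.
  by have := lam_row v (Ordinal jk); rewrite vH mxE.
have P0 : P = 0.
  apply: vanish_eq0 => // x xl.
  have := lam_vanish _ PP xl; rewrite hornerM => /(_ _)/eqP.
  rewrite mulf_eq0 orbb => h; apply/eqP/h => y _.
  by rewrite hornerM -expr2 sqr_ge0.
apply/rowP => i; rewrite mxE.
have := congr1 (fun Q : {poly R} => Q`_i) P0; rewrite /= coef0 => <-.
rewrite coef_sum (bigD1 i)//= coefZ coefXn eqxx mulr1 big1 ?addr0// => j ji.
by rewrite coefZ coefXn eq_sym (inj_eq val_inj) (negbTE ji) mulr0.
Qed.

Definition nu_factor : {poly R} :=
  'X^k - \sum_(i < k) ((\row_(j < k) mom m (k + s + j)) *m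
            invmx (hankel s m k)) 0 i *: 'X^i.

Lemma nu_polyE : nu_poly s m k = 'X^s * nu_factor.
Proof.
rewrite /nu_poly /nu_factor mulrBr -exprD (addnC s k) mulr_sumr; congr (_ - _).
by apply: eq_bigr => i _; rewrite -scalerAr -exprD (addnC s i).
Qed.

Lemma size_nu_factor : size nu_factor = k.+1.
Proof.
rewrite /nu_factor size_polyDl size_polyXn// size_polyN ltnS.
apply: leq_trans (size_sum _ _ _) _; apply/bigmax_leqP => i _.
by apply: leq_trans (size_scale_leq _ _) _; rewrite size_polyXn.
Qed.

Lemma nu_factor_neq0 : nu_factor != 0.
Proof. by rewrite -size_poly_eq0 size_nu_factor. Qed.

Lemma nu_factor_orth G : (size G <= k)%N -> lam (nu_factor * G) = 0.
Proof.
apply: lam_orth => j jk.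
(* The coefficients solve the Hankel system that expresses orthogonality to X^j; for j < k it
   involves moments of index at most 2k - 1 + s = n - 1. *)
rewrite /nu_factor mulrBl /lam mulrBr -scaleN1r intwD intwZ -!/(lam _).
rewrite (lam_row _ (Ordinal jk)) mulmxKV ?hankel_unitmx// mxE -exprD lamXn.
  by rewrite /= mulN1r addnAC subrr.
by move: sizeE; lia.
Qed.

Lemma nu_factor_vanish_roots :
  {in shifted_support, forall x, root nu_factor x%:R} ->
  forall z, root nu_factor z = (z \in [seq (x%:R : R) | x <- shifted_support]).
Proof.
move=> H; apply: root_full_list.
- exact: nu_factor_neq0.
- by rewrite size_nu_factor size_map ltnS size_shifted_support.
- exact: uniq_shifted_support.
- by apply/allP => _ /mapP[x xl ->]; apply: H.
Qed.

(** Let F be [nu_factor], [l1] its positive roots of odd multiplicity, and G the product of X - z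
    over [l1]. If [l1] has fewer than k elements, F G keeps one sign on the support while its
    integral vanishes. Then F vanishes on the support, whose points are its k roots. *)
Lemma nu_factor_roots : exists l : seq R, [/\ uniq l, size l = k,
  forall z, root nu_factor z = (z \in l) &
  {in l, forall z, (0 < z) || (z == 0) && (s == 0)%N}].
Proof.
have [l [e [e0 ul rl He]]] := sign_change_roots nu_factor_neq0.
pose l1 := [seq z <- l | 0 < z].
have ul1 : uniq l1 by exact: filter_uniq.
have rl1 : all (root nu_factor) l1.
  by apply/allP => z; rewrite mem_filter => /andP[_ /(allP rl)].
have [kl|lk] := leqP k (size l1).
  have H := root_full_list nu_factor_neq0 _ ul1 rl1.
  exists l1; split=> //.
  - apply/eqP; rewrite eqn_leq kl andbT.
    by have := max_poly_roots nu_factor_neq0 rl1 ul1; rewrite size_nu_factor.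
  - by apply: H; rewrite size_nu_factor.
  - by move=> z; rewrite mem_filter => /andP[->].
pose G : {poly R} := \prod_(z <- l1) ('X - z%:P).
have sG : (size G <= k)%N by rewrite size_prod_XsubC.
have FG0 : {in shifted_support, forall x, (e *: (nu_factor * G)).[x%:R] = 0}.
  apply: lam_vanish; last by rewrite lamZ nu_factor_orth ?mulr0.
  move=> x _; have := He x%:R.
  rewrite hornerZ (bigID (fun z => 0 < z))/= -[X in _ * (X * _)]big_filter -/l1 -/G.
  have [rx _|nrx] := boolP (root nu_factor x%:R).
    by rewrite hornerM (eqP rx) mul0r mulr0.
  (* The factors X - z with z at most 0 are positive at x: x is at least 0 and differs from z,
     because F does not vanish at x. *)
  rewrite mulrA hornerM mulrA pmulr_lge0// horner_prod big_seq_cond.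
  apply: prodr_gt0 => z /andP[zl z0]; rewrite hornerXsubC subr_gt0.
  rewrite lt_neqAle; apply/andP; split; last first.
    by apply: le_trans (ler0n _ _); rewrite leNgt.
  by apply: contraNneq nrx => <-; apply: (allP rl).
have Fs : {in shifted_support, forall x, root nu_factor x%:R}.
  move=> x /FG0; rewrite hornerZ hornerM => /eqP; rewrite !mulf_eq0 (negbTE e0) /=.
  case/orP => // h; apply: (allP rl1).
  by rewrite -root_prod_XsubC.
exists [seq (x%:R : R) | x <- shifted_support]; split.
- exact: uniq_shifted_support.
- rewrite size_map; apply/eqP; rewrite eqn_leq size_shifted_support andbT.
  have := max_poly_roots nu_factor_neq0 _ uniq_shifted_support.
  rewrite size_map size_nu_factor; apply.
  by apply/allP => _ /mapP[x xl ->]; apply: Fs.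
- exact: nu_factor_vanish_roots.
- move=> _ /mapP[x xl ->]; rewrite ltr0n pnatr_eq0.
  by move: xl; rewrite mem_shifted_support => /andP[_]; lia.
Qed.

Let root_nu z : root (nu_poly s m k) z = (z == 0) && (s == 1)%N || root nu_factor z.
Proof.
rewrite nu_polyE rootM; congr (_ || _); rewrite /root hornerXn expf_eq0.
by rewrite andbC; congr (_ && _); move: s1; lia.
Qed.

Let mem_supp_nu (y : seq R) z :
  (z \in supp_nu (size m).+1 y) = (z == 0) && (s == 1)%N || (z \in y).
Proof. by rewrite /supp_nu /s; case: odd; rewrite ?inE ?andbT ?andbF. Qed.

Lemma exists_nu_points : exists y, is_nu_points m y.
Proof.
have [l [ul sl rl l0]] := nu_factor_roots.
exists (sort <=%R l); split.
- by rewrite size_sort sl.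
- have sol : sorted <%R (sort <=%R l) by rewrite sort_lt_sorted.
  rewrite /supp_nu; case: ifP => // on /=.
  rewrite path_min_sorted//; apply/allP => z; rewrite mem_sort => /l0.
  by rewrite /s on andbF orbF.
- move=> x; rewrite -/s -/k root_nu mem_supp_nu rl.
  by rewrite mem_sort.
Qed.

Section NuPoints.
Variable y : seq R.
Hypothesis ny : is_nu_points m y.

(** For s = 1 the root 0 of [nu_poly] comes from the factor X alone: 0 is no root of [nu_factor],
    and the strict order of 0 :: y keeps it out of y. *)
Let root_y z : root nu_factor z = (z \in y).
Proof.
have [sy soy ry] := ny.
have [l [ul sl rl l0]] := nu_factor_roots.
have := ry z; rewrite -/s -/k root_nu mem_supp_nu.
have [zs|_ /= ->//] := boolP ((z == 0) && (s == 1)%N).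
case/andP: zs => /eqP-> /eqP s1E _.
have -> : root nu_factor 0 = false.
  by rewrite rl; apply/negP => /l0; rewrite ltxx s1E andbF.
apply/esym/negP => y0; move: soy; rewrite /supp_nu ifT; last first.
  by move: s1E; rewrite /s; case: odd.
rewrite lt_sorted_uniq_le /= => /andP[/andP[]].
by rewrite y0.
Qed.

Lemma nu_points_ge0 : {in y, forall z, 0 <= z}.
Proof.
have [l [ul sl rl l0]] := nu_factor_roots.
move=> z; rewrite -root_y rl => /l0.
by case/orP => [/ltW//|/andP[/eqP-> _]].
Qed.

Section IndexMinimal.
Hypothesis cp : index_minimal p K m.

(* Otherwise the sign of the orthogonal polynomial is constant on each of the
   k pairs carrying the measure, so that some polynomial of degree < k has
   exactly these signs. *)
Lemma nu_points_integral :
  (forall D, gapped s D -> size D = k ->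
     (forall x, p x != 0 -> covered s D x) ->
     forall a z, a \in D -> z \in y -> ~ (a%:R < z < a.+1%:R)) ->
  {in shifted_support, forall x, root nu_factor x%:R}.
Proof.
have [_ [D [gD sD cD]]] := cp; move=> /(_ D gD sD cD) H.
(* The two values will not have opposite signs, so the sign of their sum serves both, even if one of
   them vanishes. *)
pose e a : R := if 0 <= nu_factor.[a%:R] + nu_factor.[a.+1%:R] then 1 else -1.
have e0 a : e a != 0 by rewrite /e; case: ifP; rewrite ?oppr_eq0 oner_eq0.
have He a : a \in D ->
    0 <= e a * nu_factor.[a%:R] /\ 0 <= e a * nu_factor.[a.+1%:R].
  move=> aD; have : 0 <= nu_factor.[a%:R] * nu_factor.[a.+1%:R].
    rewrite leNgt; apply/negP => /poly_ivtoo[]; first by rewrite ler_nat.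
    move=> z; rewrite in_itv /= => zi; rewrite root_y => zy.
    exact: (H a z aD zy).
  by rewrite /e; case: ifP => h h'; split; nra.
have sD0 : (0 < size D)%N by rewrite sD.
have [G [sG _ HG]] : exists G, [/\ (size G <= size D)%N, True &
    {in D, forall b, 0 < e b * G.[b%:R] /\ 0 < e b * G.[b.+1%:R]}].
  move: gD sD0; clear -e0; case: D => // a D gD _.
  by have [G [? _ ?]] := gapped_sign_poly gD e0; exists G.
have inD x : x \in shifted_support -> in_pairs D x.
  rewrite mem_shifted_support => /andP[px sx].
  by have := cD x px; rewrite /covered ltnNge sx.
have FG x : x \in shifted_support ->
    exists2 c : R, 0 <= c * nu_factor.[x%:R] & 0 < c * G.[x%:R].
  move=> /inD /hasP[a aD] /orP[] /eqP->; exists (e a);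
  by have [? ?] := He a aD; have [? ?] := HG a aD.
have FG0 : {in shifted_support, forall x, (nu_factor * G).[x%:R] = 0}.
  apply: lam_vanish; last by apply: nu_factor_orth; rewrite (leq_trans sG) // sD.
  by move=> x /FG[c h1 h2]; rewrite hornerM; nra.
move=> x xl; have := FG0 x xl; rewrite hornerM => /eqP.
rewrite mulf_eq0 => /orP[//|/eqP Gx].
by have [c _] := FG x xl; rewrite Gx mulr0 ltxx.
Qed.

Lemma supp_nu_integral : ([set` supp_nu (size m).+1 y] `<=` @N0 R)%classic ->
  [set` supp_nu (size m).+1 y]%classic = [set x%:R | x in [set x | p x != 0]]%classic.
Proof.
move=> yN.
have Fs : {in shifted_support, forall x, root nu_factor x%:R}.
  apply: nu_points_integral => D _ _ _ a z _ zy.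
  have /natrP[b ->] : z \is a Num.nat.
    by apply: yN; rewrite /= mem_supp_nu zy orbT.
  by rewrite !ltr_nat; lia.
have H := nu_factor_vanish_roots Fs.
apply/seteqP; split=> z /=.
  rewrite mem_supp_nu -root_y H.
  case/orP => [/andP[/eqP-> /eqP s1E]|/mapP[x xl ->]]; last first.
    by exists x => //; move: xl; rewrite mem_shifted_support => /andP[].
  exists 0%N => //.
  (* For s = 1 there is mass at 0: otherwise the pairs starting at the at most k points of the
     shifted support would carry p, against positivity in degree 2k = [size m]. *)
  have [||x px] := @Ireal_uncovered _ m p K 0 shifted_support k wp Im isT.
  - rewrite -(size_map (fun x : nat => x%:R : R)) -ltnS -size_nu_factor.
    apply: max_poly_roots uniq_shifted_support; first exact: nu_factor_neq0.
    by apply/allP => _ /mapP[x xl ->]; apply: Fs.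
  - by move: sizeE; lia.
  rewrite /covered /= => /hasPn xl.
  have [x0|x0] := eqVneq x 0%N; first by rewrite -x0.
  have : x \in shifted_support by rewrite mem_shifted_support px; lia.
  by move=> /xl; rewrite eqxx.
move=> [x px <-]; rewrite mem_supp_nu -root_y.
have [sx|xs] := leqP s x.
  by apply/orP; right; apply: Fs; rewrite mem_shifted_support px.
by rewrite pnatr_eq0; move: xs s1; lia.
Qed.

Lemma supp_nu_fractional : ~ ([set` supp_nu (size m).+1 y] `<=` @N0 R)%classic ->
  exists D, [/\ gapped s D, size D = k, forall x, p x != 0 -> covered s D x &
    exists a l, [/\ a \in D, (l < size y)%N & a%:R < y`_l < a.+1%:R]].
Proof.
move=> yN; apply: contrapT => H; apply: yN.
have Fs : {in shifted_support, forall x, root nu_factor x%:R}.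
  apply: nu_points_integral => D gD sD cD a z aD zy az.
  apply: H; exists D; split=> //; exists a, (index z y).
  by rewrite index_mem nth_index.
move=> z /=; rewrite mem_supp_nu -root_y (nu_factor_vanish_roots Fs).
by case/orP => [/andP[/eqP-> _]|/mapP[x _ ->]]; rewrite /N0 /=.
Qed.

End IndexMinimal.
End NuPoints.
End OrthogonalPolynomial.

(** * The base cases and the measures M_l *)

Section Weights.
Variable R : realType.
Implicit Types (P Q : {poly R}) (p q : nat -> R) (m : seq R).

Definition wsupport p : set R := [set x%:R | x in [set x | p x != 0]]%classic.

Lemma intw_widen K K' p P : (forall x, (K <= x)%N -> p x = 0) ->
  (K <= K')%N -> intw K' p P = intw K p P.
Proof.
move=> pK KK'; rewrite /intw.
rewrite -!(big_mkord xpredT (fun x => p x * P.[x%:R])) (@big_cat_nat _ _ _ K 0 K')//=.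
rewrite [X in _ + X = _]big_nat_cond [X in _ + X = _]big1 ?addr0//.
move=> x /andP[/andP[Kx _] _].
by rewrite pK ?mul0r.
Qed.

Lemma wrealizes_widen K K' p m : (K <= K')%N ->
  wrealizes p K m -> wrealizes p K' m.
Proof.
move=> KK' [p0 pK pm]; split=> // [x h|k km]; last by rewrite (intw_widen _ pK) ?pm.
by apply: pK; apply: leq_trans h.
Qed.

Lemma intw_pair K p a P : (forall x, (K <= x)%N -> p x = 0) ->
  (forall x, p x != 0 -> (x == a) || (x == a.+1)) ->
  intw K p P = p a * P.[a%:R] + p a.+1 * P.[a.+1%:R].
Proof.
move=> pK pa; rewrite -(@intw_widen K (maxn K a.+2)) ?leq_maxl// /intw.
have h1 : (a < maxn K a.+2)%N by lia.
have h2 : (a.+1 < maxn K a.+2)%N by lia.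
rewrite (bigD1 (Ordinal h1))//= (bigD1 (Ordinal h2))/=; last first.
  by rewrite -val_eqE /=; lia.
rewrite big1 ?addr0// => x; rewrite -!val_eqE /= => /andP[x1 x2].
have [->|/pa] := eqVneq (p x) 0; first by rewrite mul0r.
by rewrite (negbTE x1) (negbTE x2).
Qed.

(* A measure carried by the roots of Q is determined by its first moments:
   test it against Q divided by one of its linear factors. *)
Lemma wrealizes_unique n Q p q K K' m : Pclass n Q -> n = (size m).+1 ->
  wrealizes p K m -> wrealizes q K' m ->
  (forall x, p x != 0 -> root Q x%:R) -> (forall x, q x != 0 -> root Q x%:R) ->
  p = q.
Proof.
move=> [mQ sQ [l [ul sl rl]] _] nE wp wq pQ qQ; apply/funext => x.
have [rx|nrx] := boolP (root Q x%:R); last first.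
  have [px|/pQ] := eqVneq (p x) 0; last by rewrite (negbTE nrx).
  by have [->|/qQ] := eqVneq (q x) 0; last by rewrite (negbTE nrx).
have [P QE] := factor_theorem Q _ rx.
have P0 : P != 0.
  by apply: contraTneq mQ => P0; rewrite QE P0 mul0r monicE lead_coef0 eq_sym oner_eq0.
have sP : size P = n.
  by move: sQ; rewrite QE size_Mmonic ?monicXsubC// size_XsubC addn2 => -[].
have rP y : y != x -> root Q y%:R -> P.[y%:R] = 0.
  move=> yx; rewrite QE rootM root_XsubC eqr_nat (negbTE yx) orbF.
  by move/eqP.
(* Otherwise P, of degree n - 1, would have all n roots of Q. *)
have Px : P.[x%:R] != 0.
  apply/negP => /eqP Px.
  have := @max_poly_roots _ P [seq (y%:R : R) | y <- l] P0.
  rewrite size_map sl sP ltnn => H; suff : false by []; apply: H.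
    apply/allP => _ /mapP[y yl ->]; rewrite /root.
    have [->|yx] := eqVneq y x; first by rewrite Px.
    by rewrite rP ?rl.
  by rewrite map_inj_uniq// => a b /eqP; rewrite eqr_nat => /eqP.
have wP r L : wrealizes r L m -> (forall y, r y != 0 -> root Q y%:R) ->
    Lfun P m = r x * P.[x%:R].
  move=> wr rQ; have wr' := wrealizes_widen (leq_maxl L x.+1) wr.
  rewrite (Lfun_intw wr') ?sP ?nE// /intw.
  have xL : (x < maxn L x.+1)%N by lia.
  rewrite (bigD1 (Ordinal xL))//= big1 ?addr0// => y; rewrite -val_eqE /= => yx.
  by have [->|/rQ ry] := eqVneq (r y) 0; rewrite ?mul0r// rP// mulr0.
by apply: (mulIf Px); rewrite -(wP _ _ wp pQ) -(wP _ _ wq qQ).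
Qed.

(** Here c is the total mass and z the mean, so z lies between a and a + 1 and is an endpoint
    exactly when one of the two masses vanishes. A general c allows the unnormalized weight x p of
    the case n = 3. *)
Lemma bracket_wsupport p a (c z : R) : (forall x, 0 <= p x) ->
  (forall x, p x != 0 -> (x == a) || (x == a.+1)) ->
  0 < c -> p a + p a.+1 = c -> p a * a%:R + p a.+1 * a.+1%:R = c * z ->
  bracket z = wsupport p.
Proof.
move=> p0 pa c0 pc pz.
have suppE x : p x != 0 <-> (x = a /\ p a != 0) \/ (x = a.+1 /\ p a.+1 != 0).
  split=> [px|[[->//]|[->//]]].
  by case/orP: (pa _ px) => /eqP E; [left|right]; rewrite -E.
have zE : c * (z - a%:R) = p a.+1.
  by rewrite mulrBr -pz -pc -natr1; ring.
have zE' : c * (a.+1%:R - z) = p a.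
  by rewrite mulrBr -pz -pc -natr1; ring.
have [z1|z1] := eqVneq (p a.+1) 0.
  have {}zE : z = a%:R.
    by move/eqP: zE; rewrite z1 mulf_eq0 gt_eqF//= subr_eq0 => /eqP.
  have pa0 : p a != 0 by apply: contraTneq c0 => h; rewrite -pc h z1 addr0 ltxx.
  rewrite /bracket zE natr_nat; apply/seteqP; split=> [y ->|y [x /suppE + <-]].
    by exists a.
  by case=> [[-> _]//|[_]]; rewrite z1 eqxx.
have [z2|z2] := eqVneq (p a) 0.
  have {}zE : z = a.+1%:R.
    by move/eqP: zE'; rewrite z2 mulf_eq0 gt_eqF//= subr_eq0 => /eqP.
  rewrite /bracket zE natr_nat; apply/seteqP; split=> [y ->|y [x /suppE + <-]].
    by exists a.+1.
  by case=> [[_]|[-> _]//]; rewrite z2 eqxx.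
have za : a%:R < z.
  by rewrite -subr_gt0 -(pmulr_rgt0 _ c0) zE lt_neqAle eq_sym z1 p0.
have za' : z < a.+1%:R.
  by rewrite -subr_gt0 -(pmulr_rgt0 _ c0) zE' lt_neqAle eq_sym z2 p0.
have nz : z \isn't a Num.nat.
  by apply/negP => /natrP[b bE]; move: za za'; rewrite bE !ltr_nat; lia.
have -> : bracket z = [set a%:R; a.+1%:R]%classic.
  rewrite /bracket (negbTE nz) /rfloor (@floor_def _ _ a%:Z).
    by rewrite natr1.
  by rewrite (ltW za) /= -[_ + 1]/((a + 1)%:Z) addn1.
apply/seteqP; split=> [y [->|->]|y [x /suppE + <-]].
- by exists a.
- by exists a.+1.
- by case=> [[-> _]|[-> _]]; [left|right].
Qed.

Lemma wsupport_two p K (m1 : R) : Ireal [:: m1] ->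
  index_minimal p K [:: m1] -> wsupport p = bracket m1.
Proof.
move=> Im [[p0 pK pm] [[|a [|? ?]] [gD]]]//= _ cD.
have pa x : p x != 0 -> (x == a) || (x == a.+1).
  by move=> /cD; rewrite /covered /= orbF.
apply/esym/(@bracket_wsupport _ a 1) => //.
  by have := pm 0%N isT; rewrite (intw_pair _ pK pa) !hornerXn !expr0 !mulr1.
by have := pm 1%N isT; rewrite (intw_pair _ pK pa) !hornerXn !expr1 mul1r.
Qed.

(** The weight x p lives on one pair, with mass m_1 and mean m_2 / m_1. By [Ireal], p does not live
    on 0 alone, which gives m_1 > 0, nor on the pair alone, which puts 0 into the support. *)
Lemma wsupport_three p K (m1 m2 : R) : Ireal [:: m1; m2] ->
  index_minimal p K [:: m1; m2] ->
  wsupport p = ([set 0] `|` bracket (m2 / m1))%classic.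
Proof.
move=> Im [wp [[|a [|? ?]] [gD]]]//= _ cD; have /andP[a0 _] := gD.
have [p0 pK pm] := wp.
pose q x := p x * x%:R.
have q0 x : 0 <= q x by rewrite mulr_ge0.
have qK x : (K <= x)%N -> q x = 0 by move=> /pK; rewrite /q => ->; rewrite mul0r.
have qa x : q x != 0 -> (x == a) || (x == a.+1).
  rewrite mulf_eq0 negb_or pnatr_eq0 => /andP[/cD].
  by rewrite /covered /= orbF; case: x.
have qm k : (k <= 1)%N ->
    q a * a%:R ^+ k + q a.+1 * a.+1%:R ^+ k = mom [:: m1; m2] k.+1.
  move=> k1; rewrite -pm//; transitivity (intw K q 'X^k).
    by rewrite (intw_pair _ qK qa) !hornerXn.
  by apply: eq_bigr => x _; rewrite !hornerXn exprS mulrA.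
have m1E : q a + q a.+1 = m1.
  by have := qm 0%N isT; rewrite !expr0 !mulr1.
have m10 : 0 < m1.
  have [x px] := @Ireal_uncovered _ _ p K 1 [::] 0 wp Im isT isT isT.
  rewrite /covered orbF -leqNgt => x0.
  have qx : q x != 0 by rewrite mulf_neq0// pnatr_eq0 -lt0n.
  have := q0 a; have := q0 a.+1; have := q0 x; rewrite le_eqVlt eq_sym (negbTE qx) /=.
  by rewrite -m1E; case/orP: (qa _ qx) => /eqP->; lra.
rewrite (@bracket_wsupport q a m1)//; last first.
  by have := qm 1%N isT; rewrite !expr1 => ->; rewrite mulrCA divff ?mulr1// gt_eqF.
have p00 : p 0%N != 0.
  have [x px] := @Ireal_uncovered _ _ p K 0 [:: a] 1 wp Im isT isT isT.
  have := cD x px; rewrite /covered /= !orbF.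
  by case: x px => // x _; lia.
apply/seteqP; split=> [_ [x px <-]|_ [->|[x qx <-]]].
- have [->|x0] := eqVneq x 0%N; first by left.
  by right; exists x => //=; rewrite mulf_neq0// pnatr_eq0.
- by exists 0%N.
- by exists x => //; move: qx => /=; rewrite mulf_eq0 negb_or => /andP[].
Qed.

End Weights.

(** * Weights tilted by a pair *)

Section Recursion.
Variables (R : realType) (m : seq R) (p : nat -> R) (K : nat) (a : nat).
Hypotheses (m3 : (3 <= size m)%N) (wp : wrealizes p K m) (Im : Ireal m).
Implicit Types (P : {poly R}).

Let N : R := mom m 2 - (2 * a%:R + 1) * mom m 1 + a%:R * (a%:R + 1).

(** For a = Y_l this weight realizes M_l(m): the quadratic density is nonnegative on the natural
    numbers and removes exactly the points a and a + 1. *)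
Definition tilted_weight (x : nat) : R :=
  p x * ((x%:R - a%:R) * (x%:R - a.+1%:R)) / N.

Let intw_pairpoly k : (k + 2 <= size m)%N ->
  intw K p ('X^k * pairpoly R 0 [:: a]) =
  mom m (k + 2) - (2 * a%:R + 1) * mom m (k + 1) + a%:R * (a%:R + 1) * mom m k.
Proof.
have [_ _ H] := wp => km; rewrite -!H; try lia.
rewrite /intw !mulr_sumr -sumrB -big_split; apply: eq_bigr => x _ /=.
rewrite hornerM horner_pairpoly big_cons big_nil !hornerXn !exprD expr0 -natr1.
by rewrite expr2 expr1; ring.
Qed.

Let N_E : intw K p (pairpoly R 0 [:: a]) = N.
Proof.
by have := @intw_pairpoly 0 ltac:(lia); rewrite expr0 mul1r mom0 mulr1.
Qed.

(** If N were 0, p would live on {a, a + 1}; as [size m] is at least 3, a single pair is few enough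
    to contradict [Ireal]. *)
Lemma tilt_norm_gt0 : 0 < N.
Proof.
have [p0 pK _] := wp; rewrite lt_neqAle -N_E; apply/andP; split; last first.
  by apply: intw_ge0 => // x _; apply: pairpoly_ge0.
apply/eqP => /esym H.
have s1 : (odd (size m).+1 <= 1)%N by case: odd.
have [||x px] := @Ireal_uncovered _ m p K (odd (size m).+1) [:: a]
  ((size m).+1./2).-1 wp Im s1.
- by move: m3; rewrite /=; lia.
- by have := odd_double_half (size m).+1; move: m3; lia.
have := intw_eq0 p0 pK (fun x _ => pairpoly_ge0 R 0 [:: a] x) H px.
move=> /eqP; rewrite pairpoly_eq0// /covered ltn0 /= => ->.
by rewrite orbT.
Qed.

Lemma tilted_weight_neq0 x :
  (tilted_weight x != 0) = [&& p x != 0, x != a & x != a.+1].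
Proof.
rewrite /tilted_weight mulf_eq0 invr_eq0 (gt_eqF tilt_norm_gt0) orbF.
by rewrite mulf_eq0 pair_eq0 !negb_or.
Qed.

Lemma intw_tilted P :
  intw K tilted_weight P = intw K p (P * pairpoly R 0 [:: a]) / N.
Proof.
rewrite /intw mulr_suml; apply: eq_bigr => x _.
rewrite hornerM horner_pairpoly big_cons big_nil expr0 /tilted_weight; ring.
Qed.

Lemma size_Mvec Y : size (Mvec m Y) = (size m - 2)%N.
Proof. by rewrite size_map size_iota. Qed.

Lemma mom_Mvec k : (k <= size m - 2)%N -> mom (Mvec m a%:R) k = Mentry m a%:R k.
Proof.
case: k => [_|k km].
  by rewrite mom0 /Mentry !add0n mom0 mulr1 divff// gt_eqF// tilt_norm_gt0.
by rewrite /mom /= (nth_map 0%N) ?size_iota// nth_iota// add1n.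
Qed.

Lemma wrealizes_tilted : wrealizes tilted_weight K (Mvec m a%:R).
Proof.
have [p0 pK pm] := wp; split.
- by move=> x; rewrite divr_ge0 ?(ltW tilt_norm_gt0)// mulr_ge0// pair_ge0.
- by move=> x Kx; rewrite /tilted_weight pK// !mul0r.
- rewrite size_Mvec => k km; rewrite intw_tilted intw_pairpoly; last by lia.
  by rewrite mom_Mvec.
Qed.

(** Up to the factor N, the functional of M_l(m) at a [pairpoly] is the integral of its product with
    the pair of a. This product may have double roots, so its positivity is derived from a point of
    the support outside all these pairs. *)
Lemma Ireal_Mvec : Ireal (Mvec m a%:R).
Proof.
have [p0 pK pm] := wp; move=> s D s1 gD; rewrite size_Mvec => Dm.
rewrite (Lfun_intw wrealizes_tilted) ?size_pairpoly ?size_Mvec; last by lia.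
rewrite intw_tilted divr_gt0 ?tilt_norm_gt0//.
have P0 x : p x != 0 -> 0 <= (pairpoly R s D * pairpoly R 0 [:: a]).[x%:R].
  by rewrite hornerM mulr_ge0 ?pairpoly_ge0.
rewrite lt_neqAle intw_ge0// andbT; apply/eqP => /esym H.
have [||x px] := @Ireal_uncovered _ m p K s (a :: D) (size D).+1 wp Im s1.
- by [].
- by move: Dm m3; lia.
move=> /negP; apply; have := intw_eq0 p0 pK P0 H px.
move=> /eqP; rewrite hornerM mulf_eq0 !pairpoly_eq0//.
by rewrite /covered /in_pairs /=; lia.
Qed.

Lemma index_minimal_tilted D : gapped (odd (size m).+1) D ->
  size D = (size m).+1./2 -> (forall x, p x != 0 -> covered (odd (size m).+1) D x) ->
  a \in D -> index_minimal tilted_weight K (Mvec m a%:R).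
Proof.
move=> gD sD cD aD; split; first exact: wrealizes_tilted.
have sE : size m = (size m - 2).+2 by lia.
exists (rem a D); rewrite size_Mvec.
have -> : odd (size m - 2).+1 = odd (size m).+1 by rewrite [in RHS]sE /= negbK.
split.
- exact: gapped_rem.
- by rewrite size_rem// sD [in LHS]sE.
- move=> x; rewrite tilted_weight_neq0 => /and3P[/cD + xa xa1].
  by rewrite /covered (in_pairs_rem _ gD aD) (negbTE xa) (negbTE xa1).
Qed.

End Recursion.

(** * Probability measures on the natural numbers *)

Section MeasuresOnNaturals.
Variable R : realType.
Local Notation T := (measurableTypeR R).
Implicit Types (mu : probability (measurableTypeR R) R) (p : nat -> R) (m : seq R).
Local Open Scope classical_set_scope.
Local Open Scope ereal_scope.

Lemma measurable_nat_point (n : nat) : measurable ([set n%:R] : set T).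
Proof. exact: measurable_set1. Qed.

Lemma N0_bigcup : @N0 R = \bigcup_n [set n%:R].
Proof.
apply/seteqP; split=> x; first by move=> /natrP[n ->]; exists n.
by move=> [n _ ->]; rewrite /N0 /=.
Qed.

Lemma measurable_N0 : measurable (@N0 R : set T).
Proof.
by rewrite N0_bigcup; apply: bigcup_measurable => n _; apply: measurable_nat_point.
Qed.

Lemma measurable_N0C : measurable (~` @N0 R : set T).
Proof. by apply: measurableC; exact: measurable_N0. Qed.

Lemma integral_nat mu (f : T -> \bar R) : mu (~` @N0 R) = 0 ->
  (forall x, 0 <= f x) -> measurable_fun [set: T] f ->
  \int[mu]_x f x = \sum_(0 <= n <oo) (f n%:R * mu [set n%:R]).
Proof.
move=> muN f0 mf.
have mN := measurable_N0C.
rewrite (ge0_negligible_integral mN)// setTD setCK N0_bigcup.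
rewrite ge0_integral_bigcup//.
- apply: eq_eseriesr => n _.
  rewrite -integral_cst; last exact: measurable_nat_point.
  by apply: eq_integral => x /set_mem ->.
- exact: measurable_funTS.
- apply/trivIsetP => i j _ _ ij; apply/eqP; rewrite set1I/=.
  by case: ifPn => // /set_mem /eqP; rewrite eqr_nat (negbTE ij).
Qed.

Lemma measurable_abs_expr k : measurable_fun [set: T] (fun x : T => (`|x ^+ k|%R)%:E).
Proof.
by apply/measurable_EFinP; apply: measurableT_comp.
Qed.

Lemma measurable_expr k : measurable_fun [set: T] (fun x : T => (x ^+ k)%:E).
Proof. by apply/measurable_EFinP; apply: exprn_measurable. Qed.

Lemma integral_expr mu k : mu (~` @N0 R) = 0 ->
  \int[mu]_x (x ^+ k)%:E = \sum_(0 <= n <oo) ((n%:R ^+ k)%:E * mu [set n%:R]).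
Proof.
(* [integral_nat] asks for a function that is nonnegative on the whole line; the absolute value
   changes nothing on N0. *)
move=> muN; transitivity (\int[mu]_x (`|x ^+ k|%R)%:E).
  apply: ae_eq_integral => //.
  - exact: measurable_expr.
  - exact: measurable_abs_expr.
  exists (~` @N0 R); split=> //; first exact: measurable_N0C.
  move=> x /= H xN; apply: H => _.
  by rewrite ger0_norm// exprn_ge0// natr_ge0.
rewrite integral_nat//; last exact: measurable_abs_expr.
by apply: eq_eseriesr => n _; rewrite ger0_norm// exprn_ge0.
Qed.

Lemma realizes_series (X : set R) mu m : mu (~` X) = 0 -> mu (~` @N0 R) = 0 ->
  realizes X mu m <-> forall k, (k <= size m)%N ->
    \sum_(0 <= n <oo) ((n%:R ^+ k)%:E * mu [set n%:R]) = (mom m k)%:E.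
Proof.
move=> muX muN; split=> [[_ H] [_|k km]|H].
- rewrite -integral_expr//.
  under eq_integral do rewrite expr0.
  by rewrite integral_cst// mul1e; exact: probability_setT.
- by rewrite -integral_expr//; have [_ ->] := H k.+1 km.
split=> // k /andP[_ km]; split; last by rewrite integral_expr// H.
apply/integrableP; split; first exact: measurable_expr.
rewrite (_ : (fun x => _) = (fun x : T => (`|x ^+ k|%R)%:E)); last by [].
rewrite integral_nat//; last exact: measurable_abs_expr.
rewrite (_ : (\sum_(0 <= n <oo) _) = (mom m k)%:E) ?ltry//.
rewrite -H//; apply: eq_eseriesr => n _.
by rewrite ger0_norm// exprn_ge0.
Qed.

Section Construction.
Variable p : nat -> R.
Hypothesis p0 : forall x, (0 <= p x)%R.
Hypothesis p1 : \sum_(0 <= x <oo) (p x)%:E = 1.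

Let dirac_weight (x : nat) : {measure set T -> \bar R} :=
  mscale (NngNum (p0 x)) (\d_(x%:R : T)).

Definition weight_measure : set T -> \bar R := mseries dirac_weight 0.

HB.instance Definition _ := Measure.on weight_measure.

Let weight_measure_setT : weight_measure setT = 1.
Proof.
rewrite /weight_measure /mseries -p1; apply: eq_eseriesr => x _.
transitivity ((p x)%:E * \d_(x%:R : T) [set: T]); first by [].
by rewrite diracT mule1.
Qed.

HB.instance Definition _ :=
  Measure_isProbability.Build _ _ R weight_measure weight_measure_setT.

Lemma weight_probability : exists mu, mu (~` @N0 R) = 0 /\
  forall x : nat, mu [set x%:R] = (p x)%:E.
Proof.
pose mu : probability T R := weight_measure.
have muE A : mu A = \sum_(0 <= x <oo) ((p x)%:E * \d_(x%:R : T) A) by [].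
exists mu; split=> [|x].
  rewrite muE eseries0// => n _ _.
  rewrite diracE memNset ?mule0//; apply; by rewrite /N0 /=.
rewrite muE (@nneseriesD1 _ _ x)//; last first.
  by move=> n _; rewrite mule_ge0 ?lee_fin.
rewrite diracE mem_set// mule1 eseries0 ?adde0// => n _ /= nx.
rewrite diracE memNset ?mule0//= => /eqP.
by rewrite eqr_nat (negbTE nx).
Qed.

End Construction.

Lemma realizes_of_weights p m : (forall x, (0 <= p x)%R) ->
  (forall k, (k <= size m)%N ->
    \sum_(0 <= n <oo) (p n * n%:R ^+ k)%:E = (mom m k)%:E) ->
  exists mu, [/\ realizes (@N0 R) mu m, mu (~` @N0 R) = 0 &
    forall x : nat, mu [set x%:R] = (p x)%:E].
Proof.
move=> p0 H; have [|mu [muN mup]] := @weight_probability p p0.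
  rewrite -[RHS](H 0%N isT); apply: eq_eseriesr => n _.
  by rewrite expr0 mulr1.
exists mu; split=> //; apply/realizes_series => // k km; rewrite -H//.
by apply: eq_eseriesr => n _; rewrite mup -EFinM mulrC.
Qed.

Lemma eseries_intw p K k : (forall x, (0 <= p x)%R) ->
  (forall x, (K <= x)%N -> p x = 0%R) ->
  \sum_(0 <= n <oo) (p n * n%:R ^+ k)%:E = (intw K p 'X^k)%:E.
Proof.
move=> p0 pK; rewrite (nneseries_split 0 K); last first.
  by move=> n _; rewrite lee_fin mulr_ge0// exprn_ge0.
rewrite add0n eseries0 ?adde0; last by move=> n Kn _; rewrite pK// mul0r.
rewrite sumEFin big_mkord; congr (_%:E); apply: eq_bigr => x _.
by rewrite hornerXn.
Qed.

Lemma open_N0C : open (~` @N0 R).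
Proof.
rewrite openE => x xN.
pose M := Num.truncn (x + 1).
pose A : set R := [set n%:R | n in `I_M.+1].
have cA : closed A.
  apply: (accessible_finite_set_closed.1 _).
    exact/hausdorff_accessible/norm_hausdorff.
  exact/finite_image/finite_II.
have oU : open (ball x 1%R `&` ~` A) by
  apply: openI; [exact: ball_open|exact: closed_openC].
rewrite /interior /= nbhsE; exists (ball x 1%R `&` ~` A); first split=> //.
  split; first exact/ballxx/ltr01.
  by move=> [n _ xE]; apply: xN; rewrite -xE /N0 /=.
move=> y [yx yA] /natrP[n yE]; apply: yA; exists n => //=.
have h : (n%:R <= x + 1)%R.
  by move: yx; rewrite yE /ball /= ltr_distlC => /andP[_ /ltW]; rewrite addrC.
by rewrite ltnS truncn_ge_nat// (le_trans _ h).
Qed.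

Lemma msupport_nat mu p : mu (~` @N0 R) = 0 ->
  (forall x : nat, mu [set x%:R] = (p x)%:E) -> msupport mu = wsupport p.
Proof.
move=> muN mup; apply/seteqP; split=> x.
  move=> sx; have [xN|xN] := pselect (@N0 R x).
    move/natrP: xN => [n xE]; exists n => //=; apply/negP => /eqP pn.
    have := sx (ball x 1%R) (ball_open _ _) (ballxx _ ltr01).
    rewrite lt_neqAle => /andP[/eqP + _]; apply; apply/esym.
    have mB : measurable (ball x 1%R : set T).
      by apply: open_measurable; exact: ball_open.
    apply: (@subset_measure0 _ T _ mu (ball x 1%R) ([set n%:R] `|` ~` @N0 R)) => //.
    - apply: measurableU; first exact: measurable_nat_point.
      exact: measurable_N0C.
    - move=> y; rewrite /ball /= xE => yn.
      have [/natrP[b yE]|] := pselect (@N0 R y); last by right.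
      left; rewrite yE /=; congr (_%:R).
      move: yn; rewrite yE ltr_distlC ltrBlDr !natr1 !ltr_nat; lia.
    - transitivity (mu [set n%:R]); last by rewrite mup pn.
      exact: (@measureU0 _ T _ mu _ _ (measurable_nat_point n) measurable_N0C muN).
  exfalso; have := sx _ open_N0C xN.
  by rewrite muN ltxx.
move=> [n /= pn <-] U oU Un.
have mU : measurable (U : set T) by exact: open_measurable.
apply: (@lt_le_trans _ _ (mu [set n%:R])); last first.
  have mn := measurable_nat_point n.
  apply: (@le_measure _ T _ mu [set n%:R] U (mem_set mn) (mem_set mU)).
  by move=> _ ->.
rewrite lt_neqAle measure_ge0 andbT eq_sym mup.
by rewrite eqe.
Qed.

(* The complement of the support is covered by the null rational balls. *)
Lemma msupportC mu (A : set R) : measurable (A : set T) ->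
  msupport mu `<=` A -> mu (~` A) = 0.
Proof.
move=> mA sA; pose B (c : rat * rat) : set T := ball (ratr c.1 : R) (ratr c.2 : R).
have mB c : measurable (B c).
  by apply: open_measurable; exact: ball_open.
pose F (k : nat) : set T := if unpickle k is Some c then
  if mu (B c) == 0 then B c else set0 else set0.
have : mu.-negligible (\bigcup_k F k).
  apply: negligible_bigcup => k; rewrite /F.
  case: unpickle => [c|]; last exact: negligible_set0.
  case: eqP => [e|_]; last exact: negligible_set0.
  by exists (B c); split; [exact: mB|exact: e|].
move=> H; apply: measure_negligible; first exact: measurableC.
apply: negligibleS H => x nAx.
have : ~ msupport mu x by move=> /sA.
move=> /existsNP[U /not_implyP[oU /not_implyP[Ux /negP]]].
rewrite lt_neqAle measure_ge0 andbT negbK => /eqP U0.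
have [c [r [xB BU]]] := open_subball_rat oU (mem_set Ux).
have [k kE] : exists k, unpickle k = Some (c, r).
  by exists (pickle (c, r)); exact: pickleK.
exists k; first exact: I; rewrite /F kE ifT; first exact/set_mem.
have mU : measurable (U : set T) by exact: open_measurable.
by apply/eqP; apply: (@subset_measure0 _ T _ mu _ U (mB (c, r)) mU BU).
Qed.

End MeasuresOnNaturals.

(** * Correctness of the algorithm *)

Section Algorithm.
Variable R : realType.
Implicit Types (mu : probability (measurableTypeR R) R) (p : nat -> R).
Implicit Types (m : seq R) (Q : {poly R}).

Lemma Pclass_roots n Q : Pclass n Q ->
  exists l : seq nat, forall x : R, root Q x = (x \in [seq (a%:R : R) | a <- l]).
Proof.
move=> [mQ sQ [l [ul sl rl]] _]; exists l; apply: root_full_list.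
- exact: monic_neq0.
- by rewrite sQ size_map sl.
- by rewrite map_inj_uniq// => a b /eqP; rewrite eqr_nat => /eqP.
- by apply/allP => _ /mapP[a al ->]; apply: rl.
Qed.

Lemma weights_realized p K m : wrealizes p K m ->
  exists mu, realizes setT mu m /\ msupport mu = wsupport p.
Proof.
move=> [p0 pK pm]; have [|mu [[_ rmu] muN mup]] := @realizes_of_weights R p m p0.
  by move=> k km; rewrite (eseries_intw _ p0 pK) pm.
exists mu; split; last exact: msupport_nat.
by split=> //; rewrite setCT measure0.
Qed.

Lemma weights_of_probability mu m n Q : realizes setT mu m -> Pclass n Q ->
  (msupport mu `<=` [set x | root Q x])%classic ->
  exists p K, [/\ wrealizes p K m, msupport mu = wsupport p &
    forall x, p x != 0 -> root Q x%:R].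
Proof.
move=> rmu PQ sQ; have [l rl] := Pclass_roots PQ.
have muN : mu (~` @N0 R)%classic = 0%E.
  apply: msupportC; first exact: measurable_N0.
  by move=> x /sQ /=; rewrite rl => /mapP[a _ ->]; rewrite /N0 /=.
pose p (x : nat) : R := fine (mu [set x%:R]%classic).
have mup x : mu [set x%:R]%classic = (p x)%:E.
  by rewrite fineK// fin_num_measure//; exact: measurable_nat_point.
have sE := msupport_nat muN mup.
have pQ x : p x != 0 -> root Q x%:R by move=> px; apply: sQ; rewrite sE; exists x.
have p0 x : 0 <= p x by rewrite fine_ge0.
pose K := (\max_(a <- l) a).+1.
have pK x : (K <= x)%N -> p x = 0.
  move=> Kx; apply/eqP; apply: contraLR Kx => /pQ; rewrite rl => /mapP[a al].
  by move=> /eqP; rewrite eqr_nat -ltnNge ltnS => /eqP->; apply: leq_bigmax_seq.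
exists p, K; split=> //; split=> // k km.
have muT : mu (~` [set: R])%classic = 0%E by rewrite setCT measure0.
have := (realizes_series m muT muN).1 rmu k km.
under eq_eseriesr do rewrite mup -EFinM mulrC.
by rewrite (eseries_intw _ p0 pK) => -[].
Qed.

(** When c is replaced by the n-th moment of p, the functional is integration against p and vanishes
    at Q0. At Q1, which is nonnegative on N0, it is then 0 as well, so Q1 vanishes on the
    support. *)
Lemma Lfun_min_root n Q1 Q0 m p K c : wrealizes p K m -> n = (size m).+1 ->
  Pclass n Q1 -> Pclass n Q0 -> (forall x, p x != 0 -> root Q0 x%:R) ->
  Lfun Q1 (rcons m c) <= Lfun Q0 (rcons m c) ->
  forall x, p x != 0 -> root Q1 x%:R.
Proof.
move=> wp nE [mQ1 sQ1 _ Q1ge] [mQ0 sQ0 _ _] pQ0; have [p0 pK pm] := wp.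
pose c' := intw K p 'X^n.
have wp' : wrealizes p K (rcons m c').
  split=> // k; rewrite size_rcons leq_eqVlt => /orP[/eqP->|km].
    by rewrite mom_rcons_last /c' nE.
  by rewrite mom_rcons// pm.
rewrite !Lfun_rcons ?sQ1 ?sQ0 ?nE// lerD2r -(lerD2r c').
rewrite -!Lfun_rcons ?sQ1 ?sQ0 ?nE//.
rewrite !(Lfun_intw wp') ?size_rcons ?sQ1 ?sQ0 ?nE//.
rewrite [X in _ <= X]intw_null; last by move=> x /pQ0/eqP.
move=> le0 x px; apply/eqP; apply: (intw_eq0 p0 pK _ _ px) => //.
by apply/le_anti; rewrite le0 intw_ge0.
Qed.

Lemma tilted_disjoint m p K a : (3 <= size m)%N -> wrealizes p K m -> Ireal m ->
  (wsupport (tilted_weight m p a) `&` [set a%:R; a%:R + 1] = set0)%classic.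
Proof.
move=> m3 wp Im; apply/seteqP; split=> // _ [[x /= + <-]].
rewrite (tilted_weight_neq0 a m3 wp Im) => /and3P[_ xa xa1].
by rewrite natr1 => -[]/eqP; rewrite eqr_nat ?(negbTE xa) ?(negbTE xa1).
Qed.

Lemma wsupport_tilted m p K a x : (3 <= size m)%N -> wrealizes p K m -> Ireal m ->
  p x != 0 ->
  (wsupport (tilted_weight m p a) `|` [set a%:R; a%:R + 1])%classic x%:R.
Proof.
move=> m3 wp Im px; rewrite natr1.
have [->|xa] := eqVneq x a; first by right; left.
have [->|xa1] := eqVneq x a.+1; first by right; right.
by left; exists x => //=; rewrite (tilted_weight_neq0 a m3 wp Im) px xa.
Qed.

Lemma rfloor_nat (a : nat) (z : R) : a%:R < z < a.+1%:R -> rfloor z = a%:R.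
Proof.
move=> /andP[az za]; rewrite /rfloor (@floor_def _ _ a%:Z)//.
by rewrite (ltW az) /= -[_ + 1]/((a + 1)%:Z) addn1.
Qed.

Lemma rfloor_ge0 (z : R) : 0 <= z -> exists a : nat, rfloor z = a%:R.
Proof.
move=> z0; have : 0 <= Num.floor z by rewrite floor_ge0.
by rewrite /rfloor; case: (Num.floor z) => // a _; exists a.
Qed.

(** Induction on the length, which drops by 2 in the recursion. An l for which y_l lies inside a
    pair of D is kept and its Q_l vanishes on p, so [Lfun_min_root] applies to Q_i; then mu and p,
    both carried by the roots of Q_i, agree. *)
Lemma algorithm_correct N m S p K : (size m <= N)%N -> (0 < size m)%N ->
  Ireal m -> index_minimal p K m -> algorithm m S -> S = wsupport p.
Proof.
elim: N m S p K => [|N IH] m S p K mN m0 Im cp aS; first by move: m0 mN; lia.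
case: aS Im cp mN m0 => {m S}.
- by move=> m1 Im cp _ _; rewrite (wsupport_two Im cp).
- by move=> m1 m2 Im cp _ _; rewrite (wsupport_three Im cp).
- move=> m y m4 ny yN Im cp _ m0.
  exact: (supp_nu_integral m0 cp.1 Im ny cp yN).
move=> m y Nl Q c i mu n Y kept m4 ny yN Hal HQ ki Hmin rmu smu Im cp mN m0.
have m3 : (3 <= size m)%N by [].
have wp := cp.1.
have [D [gD sD cD [a [l [aD ly al]]]]] := supp_nu_fractional m0 wp Im ny cp yN.
have YE : Y l = a%:R by exact: rfloor_nat.
have NE : Nl l = wsupport (tilted_weight m p a).
  have := Hal l ly; rewrite YE; apply: (IH _ _ _ K).
  - by rewrite size_Mvec; lia.
  - by rewrite size_Mvec; lia.
  - exact: Ireal_Mvec m3 wp Im.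
  - exact (index_minimal_tilted m3 wp Im gD sD cD aD).
have kl : kept l by split=> //; rewrite YE NE (tilted_disjoint a m3 wp Im).
have [PQl rQl] := HQ l kl; have [PQi _] := HQ i ki.
have pQi : forall x, p x != 0 -> root (Q i) x%:R.
  apply: (Lfun_min_root wp _ PQi PQl _ (Hmin l kl)) => // x px.
  by apply: (rQl x%:R); rewrite YE NE; exact: (wsupport_tilted a m3 wp Im px).
have [q [L [wq -> qQ]]] := weights_of_probability rmu PQi smu.
by rewrite (wrealizes_unique PQi _ wp wq pQi qQ).
Qed.

(** Every choice can be made: Q_l arises by adding a pair to a cover of the minimal weight for
    M_l(m), which [algorithm_correct] links to the recursive output. An index i exists because some
    l is kept, and p itself supplies the final measure. *)
Lemma algorithm_exists N m p K : (size m <= N)%N -> (0 < size m)%N ->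
  Ireal m -> index_minimal p K m -> exists S, algorithm m S.
Proof.
elim: N m p K => [|N IH] m p K mN m0 Im cp; first by move: m0 mN; lia.
have [m2|m3] := ltnP (size m) 3.
  case: m m0 m2 {Im cp mN} => [|x1 [|x2 [|? ?]]]// _ _.
    by exists (bracket x1); constructor.
  by exists ([set 0] `|` bracket (x2 / x1))%classic; constructor.
have wp := cp.1.
have [y ny] := exists_nu_points m0 wp Im.
have [yN|yN] := pselect ([set` supp_nu (size m).+1 y] `<=` @N0 R)%classic.
  by exists [set` supp_nu (size m).+1 y]%classic; apply: Alg_integral.
pose n := (size m).+1; pose Y (l : nat) : R := rfloor y`_l.
have en : (2 * n./2 + odd n)%N = n by rewrite addnC mul2n odd_double_half.
have /choice[f Hf] : forall l, exists NQ : set R * {poly R}, (l < size y)%N ->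
    [/\ algorithm (Mvec m (Y l)) NQ.1, Pclass n NQ.2 &
     (NQ.1 `|` [set Y l; Y l + 1] `<=` [set x | root NQ.2 x])%classic].
  move=> l; have [ly|yl] := ltnP l (size y); last by exists (set0, 0).
  have [a Ya] : exists a : nat, Y l = a%:R.
    apply: rfloor_ge0; apply: (nu_points_ge0 m0 wp Im ny); exact: mem_nth.
  (* For an arbitrary l the tilted weight need not be index-minimal for M_l(m); it serves to show
     that an index-minimal weight exists. *)
  have [q cq] := exists_index_minimal (wrealizes_tilted a m3 wp Im).
  have ImM : Ireal (Mvec m a%:R) by exact (Ireal_Mvec m3 wp Im).
  have sM := size_Mvec m a%:R.
  have [|| S aS] := IH _ q K _ _ ImM cq; rewrite ?sM; try lia.
  have SE : S = wsupport q.
    by apply: (@algorithm_correct N _ S q K _ _ ImM cq aS); rewrite sM; lia.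
  have [_ [D [gD sD cD]]] := cq.
  have oE : odd (size (Mvec m a%:R)).+1 = odd n.
    have e2 : size m = (size m - 2).+2 by lia.
    by rewrite sM /n [in RHS]e2 /= negbK.
  rewrite oE in gD cD.
  (* If n is odd and a = 0, the point 0 is already a root of the factor X, and the insertion starts
     at 1. *)
  pose D' := insert_pair (maxn (odd n) a) D.
  have gD' : gapped (odd n) D' by apply: gapped_insert_pair => //; lia.
  have o1 : (odd n <= 1)%N by case: odd.
  have nE : (2 * size D' + odd n)%N = n.
    by rewrite -[RHS]en size_insert_pair sD sM /n; lia.
  exists (S, pairpoly R (odd n) D') => _ /=; split; first by rewrite Ya.
    by rewrite -[X in Pclass X]nE; apply: Pclass_pairpoly.
  have cov x : (x == a) || (x == a.+1) || covered (odd n) D x ->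
      root (pairpoly R (odd n) D') x%:R.
    by move=> h; rewrite /root pairpoly_eq0//; apply: covered_insert.
  rewrite Ya SE => z [[x /= qx <-]|[->|->]] /=.
  - by apply: cov; rewrite cD ?orbT.
  - by apply: cov; rewrite eqxx.
  - by rewrite natr1; apply: cov; rewrite eqxx orbT.
pose Nl l := (f l).1; pose Q l := (f l).2.
pose kept l := (l < size y)%N /\ (Nl l `&` [set Y l; Y l + 1] = set0)%classic.
have [D [gD sD cD [a [l [aD ly al]]]]] := supp_nu_fractional m0 wp Im ny cp yN.
have YE : Y l = a%:R by exact: rfloor_nat.
have [aNl PQl rQl] := Hf l ly.
have NE : Nl l = wsupport (tilted_weight m p a).
  move: aNl; rewrite YE; apply: (@algorithm_correct N _ _ _ K).
  - by rewrite size_Mvec; lia.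
  - by rewrite size_Mvec; lia.
  - exact: Ireal_Mvec m3 wp Im.
  - exact (index_minimal_tilted m3 wp Im gD sD cD aD).
have kl : kept l by split=> //; rewrite YE NE (tilted_disjoint a m3 wp Im).
pose F (j : 'I_(size y)) : R := Lfun (Q j) (rcons m 0).
have kl' : `[< kept (Ordinal ly) >] by apply/asboolP.
have [i /asboolP ki Hi] := @arg_minP _ _ _ (Ordinal ly)
  (fun j : 'I_(size y) => `[< kept j >]) F kl'.
have [_ PQi _] := Hf i (ltn_ord i).
have pQi : forall x, p x != 0 -> root (Q i) x%:R.
  apply: (Lfun_min_root wp _ PQi PQl _ (Hi _ kl')) => // x px.
  by apply: (rQl x%:R); rewrite -/(Nl l) YE NE; exact: (wsupport_tilted a m3 wp Im px).
have [mu [rmu smu]] := weights_realized wp.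
exists (msupport mu).
apply: (@Alg_recursive _ m y Nl Q 0 i mu) => //.
- by move=> j /Hf[].
- by move=> j [/Hf[]].
- by move=> j kj; apply: (Hi (Ordinal kj.1)); apply/asboolP.
- by rewrite smu => _ [x /= /pQi ? <-].
Qed.

Lemma eseries_perturb p h K k (M : R) : (forall x, 0 <= p x) ->
  (forall x, 0 <= p x + h x) -> (forall x, (K <= x)%N -> h x = 0) ->
  (\sum_(0 <= n <oo) (p n * n%:R ^+ k)%:E = M%:E)%E ->
  (\sum_(0 <= n <oo) ((p n + h n) * n%:R ^+ k)%:E = (M + intw K h 'X^k)%:E)%E.
Proof.
move=> p0 ph0 hK.
rewrite (nneseries_split 0 K); last by move=> n _; rewrite lee_fin mulr_ge0// exprn_ge0.
move=> H; rewrite (nneseries_split 0 K); last first.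
  by move=> n _; rewrite lee_fin mulr_ge0// exprn_ge0.
rewrite EFinD -H !add0n addeAC; congr (_ + _)%E; last first.
  rewrite /=; congr (limn _); apply/funext => j.
  apply: eq_big_nat => i /andP[Ki _].
  by rewrite hK// addr0.
rewrite !sumEFin -EFinD !big_mkord /intw -big_split; congr (_%:E).
by apply: eq_bigr => x _; rewrite hornerXn mulrDl.
Qed.

(** The support of mu may a priori be infinite. The greedy cover either confines it to finitely many
    pairs or finds a chain, and then the perturbed weights would realize m with an n-th moment below
    [mt]. *)
Lemma minimal_index_minimal m mt mu : (0 < size m)%N ->
  (forall x : R, realizable (@N0 R) (rcons m x) -> mt <= x) ->
  realizes (@N0 R) mu (rcons m mt) ->
  exists p K, index_minimal p K m /\ msupport mu = wsupport p.
Proof.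
move=> m0 mtmin rmu; have muN := rmu.1; set n := (size m).+1.
pose p (x : nat) : R := fine (mu [set x%:R]%classic).
have mup x : mu [set x%:R]%classic = (p x)%:E.
  by rewrite fineK// fin_num_measure//; exact: measurable_nat_point.
have p0 x : 0 <= p x by rewrite fine_ge0.
have pm k : (k <= n)%N ->
    (\sum_(0 <= x <oo) (p x * x%:R ^+ k)%:E = (mom (rcons m mt) k)%:E)%E.
  move=> km; rewrite -((realizes_series (rcons m mt) muN muN).1 rmu k) ?size_rcons//.
  by apply: eq_eseriesr => x _; rewrite mup -EFinM mulrC.
have en : (2 * n./2 + odd n)%N = n by rewrite addnC mul2n odd_double_half.
have [[D [gD sD cD]]|[t [gt st At]]] :=
  greedy_cover (fun x => p x != 0) n./2 (odd n).
  pose K := (\max_(a <- D) a).+2.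
  have pK x : (K <= x)%N -> p x = 0.
    move=> Kx; apply/eqP; apply: contraLR Kx => /cD; rewrite -ltnNge /K.
    case/orP => [|/hasP[a aD]]; first by case: odd; lia.
    have : (a <= \max_(b <- D) b)%N by exact: (@leq_bigmax_seq _ D xpredT id a aD).
    lia.
  exists p, K; split; last exact: msupport_nat.
  split; last by exists D.
  split=> // k km; have := pm k (leqW km); rewrite mom_rcons//.
  by rewrite (eseries_intw _ p0 pK) => -[].
have pt : {in t, forall x, p x != 0} by apply/allP.
pose K := (\max_(a <- t) a).+1.
have tK : {in t, forall x, (x < K)%N}.
  by move=> x xt; rewrite ltnS; apply: (@leq_bigmax_seq _ t xpredT id x xt isT).
have [h [h1 h2 h3 h4]] := chain_perturbation p0 (leq_b1 _) gt st pt tK.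
pose x := mt + intw K h 'X^n.
have [k km|mu' [rmu' _ _]] :=
  @realizes_of_weights R (fun x => p x + h x) (rcons m x) h1.
  rewrite size_rcons -/n in km; rewrite (eseries_perturb p0 h1 h2 (pm k km)).
  move: km; rewrite leq_eqVlt => /orP[/eqP->|km]; first by rewrite !mom_rcons_last.
  by rewrite h3 ?en// addr0 !mom_rcons.
have : mt <= x by apply: mtmin; exists mu'.
rewrite /x -subr_ge0 addrAC subrr add0r -[n in 'X^n]en leNgt.
by move=> /negP.
Qed.

End Algorithm.

Theorem theorem6p7 (R : realType) (n : nat) (m : n.-1.-tuple R) (mt : R)
    (mu : probability (measurableTypeR R) R) :
  (2 <= n)%N ->
  I_realizable m ->
  realizable (@N0 R) (rcons m mt) ->
  (forall x : R, realizable (@N0 R) (rcons m x) -> mt <= x) ->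
  realizes (@N0 R) mu (rcons m mt) ->
  (exists N : set R, algorithm m N) /\
  (forall N : set R, algorithm m N -> N = msupport mu).
Proof.
move=> n2 Im _ mtmin rmu.
have m0 : (0 < size m)%N by rewrite size_tuple; move: n2; lia.
have Im' := I_realizable_Ireal m0 Im.
have [p [K [cp ->]]] := minimal_index_minimal m0 mtmin rmu.
split; first exact: (algorithm_exists (leqnn _) m0 Im' cp).
by move=> N; apply: (algorithm_correct (leqnn _) m0 Im' cp).
Qed.
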